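(* Let $d\ge4$ be even. For $(a,b)\in\mathbb{R}^2$ let $$\rho_{a,b}=\frac{1-a-b}{d^2}I_{d^2}+a|\omega_d\rangle\langle\omega_d|+\frac bd(I_d\otimes\Omega_d)F_d(I_d\otimes\Omega_d)^*,$$ let $\mathbb{P}_d,\mathbb{T},\mathbb{S}_k$ be the sets of $(a,b)\in\mathbb{R}^2$ such that $\rho_{a,b}$ is, respectively, a quantum state, a PPT quantum state, and a quantum state with Schmidt number at most $k$. Consider the $S\otimes S$-invariant quantum states $$\rho_{a,b}^\Gamma=\frac{1-a-b}{d^2}I_{d^2}+\frac adF_d+b(I_d\otimes\Omega_d)|\omega_d\rangle\langle\omega_d|(I_d\otimes\Omega_d)^*,\qquad(b,a)\in\mathbb{P}_d.$$ Then $\mathrm{SN}(\rho_{a,b}^\Gamma)=\mathrm{SN}(\rho_{b,a})$, and therefore: (1) $\rho_{a,b}^\Gamma$ is PPT if and only if $(b,a)\in\mathbb{T}$ (if and only if $(a,b)\in\mathbb{T}$); (2) $\mathrm{SN}(\rho_{a,b}^\Gamma)\le k$ if and only if $(b,a)\in\mathbb{S}_k$. In particular, there exist $S\otimes S$-invariant PPT quantum states on $\mathbb{C}^d\otimes\mathbb{C}^d$ with Schmidt number $d/2$, while every $S\otimes S$-invariant PPT state has Schmidt number at most $d/2$.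
   Context: $\Omega_d=\begin{pmatrix}0&I_{d/2}\\-I_{d/2}&0\end{pmatrix}$, $|\omega_d\rangle=\frac1{\sqrt d}\sum_{j=1}^d|jj\rangle$, $F_d=\sum_{i,j=1}^d|ij\rangle\langle ji|$, $Sp(d)=\{S\in U(d):S^\top\Omega_dS=\Omega_d\}$. A matrix $X\in M_d(\mathbb{C})\otimes M_d(\mathbb{C})$ is $S\otimes S$-invariant if $(S\otimes S)X(S\otimes S)^*=X$ for all $S\in Sp(d)$. $\rho^\Gamma=(\mathrm{id}\otimes\top)(\rho)$ is the partial transpose. A quantum state is a positive semidefinite trace-one matrix; it is PPT if its partial transpose is positive semidefinite. The Schmidt number $\mathrm{SN}(\rho)$ is the smallest $k$ such that $\rho$ is a convex combination of pure states $|\xi\rangle\langle\xi|$ with $\xi$ of Schmidt rank at most $k$. *)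

(* Defs.v *)
From mathcomp Require Import all_boot all_order all_algebra.
From mathcomp Require Import complex mxtens.
From mathcomp Require Import zify.
From mathcomp Require Import boolp classical_sets reals.

Set Implicit Arguments.
Unset Strict Implicit.
Unset Printing Implicit Defensive.

Import Order.TTheory GRing.Theory Num.Theory.

Local Open Scope ring_scope.
Local Open Scope complex_scope.
Local Open Scope sesquilinear_scope.

(* Vectors of C^d (x) C^d are columns 'cV[R[i]]_(d * d) and elements of
   M_d (x) M_d are matrices 'M[R[i]]_(d * d); the index of |ij> is
   mxtens_index (i, j), as in the Kronecker product *t of mxtens.  M ^t* is the
   conjugate transpose of M. *)

Section States.
Variables (R : realType) (d : nat).
Local Notation C := (R[i]).

Definition psd n (X : 'M[C]_n) : Prop :=
  X \is hermsymmx /\ forall v : 'cV[C]_n, 0 <= (v ^t* *m X *m v) 0 0.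

Definition quantum_state n (X : 'M[C]_n) : Prop := psd X /\ \tr X = 1.

(* (id (x) T) : the entry (ij, kl) of the result is the entry (il, kj) of X. *)
Definition ptrans (X : 'M[C]_(d * d)) : 'M[C]_(d * d) :=
  \matrix_(p, q)
    X (mxtens_index ((mxtens_unindex p).1, (mxtens_unindex q).2))
      (mxtens_index ((mxtens_unindex q).1, (mxtens_unindex p).2)).

Lemma ptrans_tens (A B : 'M[C]_d) : ptrans (A *t B) = A *t B^T.
Proof. by apply/matrixP=> p q; rewrite !mxE !mxtens_indexK. Qed.

Definition PPT_state (X : 'M[C]_(d * d)) : Prop :=
  quantum_state X /\ psd (ptrans X).

(* The rank of the coefficient matrix (xi_ij) of xi = \sum_ij xi_ij |ij>. *)
Definition schmidt_rank (xi : 'cV[C]_(d * d)) : nat :=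
  \rank (\matrix_(i < d, j < d) xi (mxtens_index (i, j)) 0).

Lemma schmidt_rank_leP (xi : 'cV[C]_(d * d)) (k : nat) :
  (schmidt_rank xi <= k)%N <->
  exists u v : 'I_k -> 'cV[C]_d, xi = \sum_(l < k) u l *t v l.
Proof.
rewrite /schmidt_rank; set M := \matrix_(i, j) _; split.
  move=> le_rk.
  have [U [V MUV]] : exists (U : 'M[C]_(d, k)) (V : 'M[C]_(k, d)), M = U *m V.
    exists (col_base M *m pid_mx (\rank M)), (pid_mx (\rank M) *m row_base M).
    rewrite mulmxA -(mulmxA (col_base M)) pid_mx_id //.
    by rewrite pid_mx_1 mulmx1 mulmx_base.
  exists (fun l => col l U), (fun l => (row l V)^T).
  apply/matrixP=> p q; rewrite (ord1 q).
  case: p / mxtens_indexP => i j.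
  have := congr1 (fun A : 'M_d => A i j) MUV; rewrite !mxE => ->.
  rewrite summxE; apply: eq_bigr => l _.
  by rewrite !mxE !mxtens_indexK.
case=> u [v xiE].
have -> : M = (\matrix_(i < d, l < k) u l i 0) *m (\matrix_(l < k, j < d) v l j 0).
  apply/matrixP=> i j; rewrite !mxE xiE summxE; apply: eq_bigr => l _.
  rewrite !mxE !mxtens_indexK /=.
  by congr (u l i _ * v l j _); apply/val_inj.
exact: leq_trans (mxrankM_maxl _ _) (rank_leq_col _).
Qed.

Definition schmidt_decomposable (k : nat) (X : 'M[C]_(d * d)) : Prop :=
  exists (n : nat) (p : 'I_n -> R) (xi : 'I_n -> 'cV[C]_(d * d)),
    [/\ forall l, 0 <= p l,
        \sum_l p l = 1,
        forall l, (xi l) ^t* *m xi l = 1%:M,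
        forall l, (schmidt_rank (xi l) <= k)%N
      & X = \sum_l (p l)%:C *: (xi l *m (xi l) ^t* )].

(* The least k such that X is schmidt_decomposable k; the value 0 is only
   taken by matrices that are not states, see SN_leP. *)
Definition SN (X : 'M[C]_(d * d)) : nat :=
  match pselect (exists k, `[< schmidt_decomposable k X >]) with
  | left exk => ex_minn exk
  | right _ => 0
  end.

Lemma SN_leP (X : 'M[C]_(d * d)) (k : nat) : quantum_state X ->
  (SN X <= k)%N <-> schmidt_decomposable k X.
Proof.
move=> [[Xherm Xpos] trX].
have mono k1 k2 : (k1 <= k2)%N ->
    schmidt_decomposable k1 X -> schmidt_decomposable k2 X.
  move=> k12 [n [p [xi [h1 h2 h3 h4 h5]]]]; exists n, p, xi; split=> // l.
  exact: leq_trans (h4 l) k12.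
have exX : schmidt_decomposable d X.
  have Pu := spectral_unitarymx X.
  have := orthomx_spectralP (hermitian_normalmx Xherm).
  set P := spectralmx X in Pu *; set D := spectral_diag X => XE.
  have PP : P *m P ^t* = 1%:M by apply/unitarymxP.
  have PP' : P ^t* *m P = 1%:M by apply: mulmx1C.
  pose xi l := (row l P) ^t*.
  have xiE l : (xi l) ^t* = row l P by rewrite /xi trmxCK.
  have XE' : X = \sum_l D 0 l *: (xi l *m (xi l) ^t* ).
    rewrite XE (invmx_unitary Pu) -mulmxA mul_diag_mx.
    apply/matrixP=> i j; rewrite summxE mxE; apply: eq_bigr => l _.
    by rewrite xiE !mxE big_ord1 !mxE mulrCA.
  have DE l : D 0 l = ((xi l) ^t* *m X *m xi l) 0 0.
    have PXP : P *m X *m P ^t* = diag_mx D.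
      by rewrite {1}XE (invmx_unitary Pu) !mulmxA PP mul1mx -mulmxA PP mulmx1.
    have -> : D 0 l = (P *m X *m P ^t* ) l l by rewrite PXP !mxE eqxx mulr1n.
    rewrite xiE -row_mul mxE [RHS]mxE; apply: eq_bigr => m _.
    by rewrite !mxE.
  have D0 l : 0 <= D 0 l by rewrite DE.
  have DR l : (complex.Re (D 0 l))%:C = D 0 l by rewrite RRe_real // ger0_real.
  exists (d * d)%N, (fun l => complex.Re (D 0 l)), xi; split.
  - by move=> l; rewrite -lecR DR.
  - apply: (@complexI R); rewrite rmorph_sum /= (eq_bigr (fun l => D 0 l)) //.
    rewrite -mxtrace_diag; transitivity (\tr X); last by rewrite trX.
    rewrite {1}XE (invmx_unitary Pu) -mulmxA mxtrace_mulC -mulmxA PP.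
    by rewrite mulmx1.
  - move=> l; rewrite xiE; apply/matrixP=> i j; rewrite !ord1.
    have := congr1 (fun A : 'M_(d * d) => A l l) PP; rewrite !mxE eqxx => <-.
    by apply: eq_bigr => m _; rewrite !mxE.
  - by move=> l; apply: rank_leq_row.
  - by rewrite {1}XE'; apply: eq_bigr => l _; rewrite DR.
rewrite /SN; case: pselect => [exk|[]]; last by exists d; apply/asboolP.
case: ex_minnP => m /asboolP mX minm; split=> [/mono|kX]; first exact.
by apply: minm; apply/asboolP.
Qed.

End States.

Section Family.
Variables (R : realType) (d : nat).
Local Notation C := (R[i]).

Definition Omega : 'M[C]_d :=
  \matrix_(i, j) ((i + d./2 == j)%N%:R - (j + d./2 == i)%N%:R).

Definition ket (i j : 'I_d) : 'cV[C]_(d * d) :=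
  (delta_mx i 0 : 'cV[C]_d) *t (delta_mx j 0 : 'cV[C]_d).

Definition omega : 'cV[C]_(d * d) := (sqrtC d%:R)^-1 *: \sum_(j < d) ket j j.

Definition Flip : 'M[C]_(d * d) :=
  \sum_(i < d) \sum_(j < d) ket i j *m (ket j i) ^t*.

Definition Sp (S : 'M[C]_d) : Prop :=
  S \is unitarymx /\ S^T *m Omega *m S = Omega.

Definition SS_invariant (X : 'M[C]_(d * d)) : Prop :=
  forall S, Sp S -> (S *t S) *m X *m (S *t S) ^t* = X.

Definition IOmega : 'M[C]_(d * d) := 1%:M *t Omega.

Definition rho (a b : R) : 'M[C]_(d * d) :=
  ((1 - a - b) / d%:R ^+ 2)%:C *: 1%:M
  + a%:C *: (omega *m omega ^t* )
  + (b / d%:R)%:C *: (IOmega *m Flip *m IOmega ^t* ).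

Local Open Scope classical_set_scope.

Definition state_region : set (R * R) :=
  [set ab | quantum_state (rho ab.1 ab.2)].

Definition PPT_region : set (R * R) :=
  [set ab | PPT_state (rho ab.1 ab.2)].

Definition SN_region (k : nat) : set (R * R) :=
  [set ab | quantum_state (rho ab.1 ab.2) /\ (SN (rho ab.1 ab.2) <= k)%N].

End Family.

Arguments Omega : clear implicits.
Arguments omega : clear implicits.
Arguments Flip : clear implicits.
Arguments IOmega : clear implicits.
Arguments rho {R} d a b.
Arguments state_region : clear implicits.
Arguments PPT_region : clear implicits.
Arguments SN_region : clear implicits.

Lemma Omega_block (R : realType) (n : nat) :
  Omega R (n + n) = block_mx 0 1%:M (- 1%:M) 0.
Proof.
have half : ((n + n)./2 = n)%N by rewrite addnn doubleK.
apply/matrixP=> i j; rewrite [LHS]mxE half.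
case: (split_ordP i) => i' ->; case: (split_ordP j) => j' ->;
  rewrite ?block_mxEul ?block_mxEur ?block_mxEdl ?block_mxEdr !mxE /=.
all: have := ltn_ord i'; have := ltn_ord j' => ltj lti.
all: try by rewrite !gtn_eqF ?subrr //; lia.
- rewrite (addnC n j') eqn_add2r (_ : (_ == nat_of_ord i')%N = false) ?subr0 //.
  lia.
- rewrite (addnC n i') eqn_add2r (_ : (_ + n == j')%N = false) ?sub0r.
    by rewrite [in LHS]eq_sym.
  lia.
Qed.

(* Main.v *)
(* Conjugation by the local unitary [I (x) Omega] exchanges [rho b a] with the
   partial transpose of [rho a b], so both have the same Schmidt number.

   The commutant of [S (x) S], [S] in [Sp(d)], is spanned by [I], [F] and
   [P' = |Omega><Omega|]: commuting with the group implies commuting with the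
   derivation [N (x) 1 + 1 (x) N] of every [N = u u^T Omega], hence lowering indices
   with [Omega] yields an invariant 4-tensor; the Casimir identity expresses
   [(d + 1) + (12) + (13) + (14)] applied to it through products of two forms, and
   this operator is invertible for [d > 2].

   Positivity of [al I + be F + ga P'] and of its partial transpose reads
   [al >= be], [al >= ga], [al - be + d ga >= 0], [al - ga + d be >= 0] (the
   constraints [al + be >= 0] and [al + ga >= 0] follow).  The extremal rays of this
   cone are [I + F + P'], [I + F], [I + P'] and [(d - 1) I - F - P'].  They are sums
   of projectors of Schmidt rank at most [d/2], because the antisymmetric vector
   [e_j e_j' - e_j' e_j] of a symplectic pair becomes a product vector after adding
   [z e_j e_j - z^* e_j' e_j'] with [|z| = 1], and averaging over [z] in
   [{1, -1, i, -i}] removes the cross terms.  Conversely every vector in the range of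
   [I + F + P'] outside the symmetric space has a coefficient matrix [M] with
   [M - M^T = c Omega], [c != 0], so [d <= 2 rank M]. *)

Require Import Defs.
From mathcomp Require Import all_boot all_order all_algebra.
From mathcomp Require Import complex mxtens.
From mathcomp Require Import ring zify.
From mathcomp Require Import boolp classical_sets reals.

Set Implicit Arguments.
Unset Strict Implicit.
Unset Printing Implicit Defensive.

Import Order.TTheory GRing.Theory Num.Theory.

Local Open Scope ring_scope.
Local Open Scope complex_scope.
Local Open Scope sesquilinear_scope.

(** * Vectorization of matrices and rank-one operators *)

Section Dyads.
Variables (C : numClosedFieldType) (d : nat).
Implicit Types (A B M N : 'M[C]_d) (X Y : 'M[C]_(d * d)) (xi : 'cV[C]_(d * d)).

(** Row-major order as in [mxtens_index], so that the Schmidt rank of [vc M] is [\rank M]. *)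
Definition vc M : 'cV[C]_(d * d) :=
  \col_p M (mxtens_unindex p).1 (mxtens_unindex p).2.

Definition unvc xi : 'M[C]_d := \matrix_(i, j) xi (mxtens_index (i, j)) 0.

Definition dyad M N : 'M[C]_(d * d) := vc M *m (vc N) ^t*.

Lemma unvcK xi : vc (unvc xi) = xi.
Proof. by apply/matrixP=> p q; rewrite (ord1 q) !mxE -surjective_pairing mxtens_unindexK. Qed.

Lemma vcK M : unvc (vc M) = M.
Proof. by apply/matrixP=> i j; rewrite !mxE mxtens_indexK. Qed.

Lemma vcD M N : vc (M + N) = vc M + vc N.
Proof. by apply/matrixP=> p q; rewrite !mxE. Qed.

Lemma vcZ c M : vc (c *: M) = c *: vc M.
Proof. by apply/matrixP=> p q; rewrite !mxE. Qed.

Lemma vcN M : vc (- M) = - vc M.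
Proof. by apply/matrixP=> p q; rewrite !mxE. Qed.

Lemma vc_sum I (r : seq I) (P : pred I) (F : I -> 'M[C]_d) :
  vc (\sum_(i <- r | P i) F i) = \sum_(i <- r | P i) vc (F i).
Proof.
by apply/matrixP=> p q; rewrite summxE !mxE summxE; apply: eq_bigr => i _; rewrite mxE.
Qed.

Lemma dyadE M N i j k l :
  dyad M N (mxtens_index (i, j)) (mxtens_index (k, l)) = M i j * (N k l)^*%R.
Proof. by rewrite !mxE big_ord1 !mxE !mxtens_indexK. Qed.

Lemma dyadDl M N A : dyad (M + N) A = dyad M A + dyad N A.
Proof. by rewrite /dyad vcD mulmxDl. Qed.

Lemma dyadDr M N A : dyad A (M + N) = dyad A M + dyad A N.
Proof. by rewrite /dyad vcD linearD map_mxD mulmxDr. Qed.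

Lemma dyadNl M A : dyad (- M) A = - dyad M A.
Proof. by rewrite /dyad vcN mulNmx. Qed.

Lemma dyadNr M A : dyad A (- M) = - dyad A M.
Proof. by rewrite /dyad vcN linearN map_mxN mulmxN. Qed.

Lemma dyadZ c M N : dyad (c *: M) (c *: N) = (c * c^*%R) *: dyad M N.
Proof.
by rewrite /dyad !vcZ linearZ /= map_mxZ -scalemxAl -scalemxAr scalerA.
Qed.

Lemma dyadZl c M N : dyad (c *: M) N = c *: dyad M N.
Proof. by rewrite /dyad vcZ -scalemxAl. Qed.

Lemma dyadZr c M N : dyad M (c *: N) = c^*%R *: dyad M N.
Proof. by rewrite /dyad vcZ linearZ /= map_mxZ -scalemxAr. Qed.

Lemma dyad_suml I (r : seq I) (F : I -> 'M[C]_d) A :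
  dyad (\sum_(i <- r) F i) A = \sum_(i <- r) dyad (F i) A.
Proof. by rewrite /dyad vc_sum mulmx_suml. Qed.

Lemma dyad_sumr I (r : seq I) (F : I -> 'M[C]_d) A :
  dyad A (\sum_(i <- r) F i) = \sum_(i <- r) dyad A (F i).
Proof. by rewrite /dyad vc_sum !raddf_sum. Qed.

Lemma tens_eqP X Y :
  (forall i j k l, X (mxtens_index (i, j)) (mxtens_index (k, l))
     = Y (mxtens_index (i, j)) (mxtens_index (k, l))) -> X = Y.
Proof.
move=> XY; apply/matrixP=> p q.
by case: p / mxtens_indexP => i j; case: q / mxtens_indexP => k l.
Qed.

Lemma sum_tens (V : nmodType) (F : 'I_(d * d) -> V) :
  \sum_p F p = \sum_i \sum_j F (mxtens_index (i, j)).
Proof.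
rewrite pair_big /= (reindex (@mxtens_index d d)) /=.
  by apply: eq_bigr => -[i j].
by exists (@mxtens_unindex d d) => p _; rewrite ?mxtens_indexK ?mxtens_unindexK.
Qed.

(** Turns local operators into two-sided multiplication, so rank bounds for products control Schmidt
    ranks. *)
Lemma tens_vc A B M : (A *t B) *m vc M = vc (A *m M *m B^T).
Proof.
apply/matrixP=> p q; rewrite (ord1 q); case: p / mxtens_indexP => i j.
rewrite mxE sum_tens !mxE mxtens_indexK /= exchange_big /=.
apply: eq_bigr => l _; rewrite !mxE mulr_suml; apply: eq_bigr => k _.
by rewrite tensmxE !mxE mxtens_indexK /=; ring.
Qed.

Lemma vc_eqP X Y : (forall M, X *m vc M = Y *m vc M) -> X = Y.
Proof.
move=> XY; apply/matrixP=> p q.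
have E (Z : 'M[C]_(d * d)) : Z p q = (Z *m delta_mx q 0 : 'cV_(d * d)) p 0.
  rewrite mxE (bigD1 q) //= big1 => [|r rq]; first by rewrite mxE !eqxx mulr1 addr0.
  by rewrite mxE (negPf rq) mulr0.
by rewrite E [RHS]E -[delta_mx q 0]unvcK XY.
Qed.

Lemma trmxC_mul m n p (U : 'M[C]_(m, n)) (V : 'M[C]_(n, p)) :
  (U *m V) ^t* = V ^t* *m U ^t*.
Proof. by rewrite trmx_mul map_mxM. Qed.

Lemma trmxC_scale m n c (U : 'M[C]_(m, n)) : (c *: U) ^t* = c^*%R *: U ^t*.
Proof. by rewrite linearZ /= map_mxZ. Qed.

Lemma trmxC_tens A B : (A *t B) ^t* = A ^t* *t B ^t*.
Proof. by rewrite trmx_tens map_mxT. Qed.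

Lemma tens_dyad A B M N :
  (A *t B) *m dyad M N *m (A *t B) ^t* = dyad (A *m M *m B^T) (A *m N *m B^T).
Proof. by rewrite /dyad !mulmxA tens_vc -mulmxA -trmxC_mul tens_vc. Qed.

Lemma vc_dot M N : ((vc M) ^t* *m vc N) 0 0 = \sum_i \sum_j (M i j)^*%R * N i j.
Proof.
rewrite mxE sum_tens; apply: eq_bigr => i _; apply: eq_bigr => j _.
by rewrite !mxE mxtens_indexK.
Qed.

Lemma sum_delta (F : 'I_d -> 'I_d -> C) x y :
  \sum_i \sum_j F i j * (delta_mx x y : 'M[C]_d) i j = F x y.
Proof.
rewrite (bigD1 x) //= (bigD1 y) //= [X in _ + X + _]big1 => [|j jy].
  rewrite mxE !eqxx mulr1 addr0 big1 ?addr0 // => i ix.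
  by rewrite big1 // => j _; rewrite mxE (negPf ix) mulr0.
by rewrite mxE (negPf jy) andbF mulr0.
Qed.

Lemma dyad_vc M N A : dyad M N *m vc A = (\sum_i \sum_j (N i j)^*%R * A i j) *: vc M.
Proof. by rewrite -mulmxA [_ ^t* *m _]mx11_scalar vc_dot mul_mx_scalar. Qed.

Lemma tr_dyad M N : \tr (dyad M N) = \sum_i \sum_j (N i j)^*%R * M i j.
Proof. by rewrite mxtrace_mulC [_ *m _]mx11_scalar vc_dot mxtrace_scalar. Qed.

(** Up to sign, the cross terms carry [z], [z ^+ 2] or a conjugate of these, and all of them sum to
    zero over the fourth roots of unity. The phases [1, -1] alone would leave the squares. *)
Lemma phase_average W B B' :
  \sum_(z <- [:: 1; -1; 'i; - 'i]%R)
    dyad (W + z *: B - z^*%R *: B') (W + z *: B - z^*%R *: B')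
  = 4%:R *: (dyad W W + dyad B B + dyad B' B').
Proof.
have i2 : 'i%R ^+ 2 = -1 :> C by rewrite sqrCi.
rewrite !big_cons big_nil addr0 !(dyadDl, dyadDr, dyadNl, dyadNr, dyadZl, dyadZr).
rewrite !(rmorphN, rmorph1) /= !conjCi ?rmorphN /= ?conjCi !opprK.
move: (dyad W W) (dyad W B) (dyad W B') (dyad B W) (dyad B B)
  (dyad B B') (dyad B' W) (dyad B' B) (dyad B' B').
move=> X1 X2 X3 X4 X5 X6 X7 X8 X9; apply/matrixP=> p q; rewrite !mxE.
by ring: i2.
Qed.

Lemma tr_dyad_gt0 M : M != 0 -> 0 < \tr (dyad M M).
Proof.
have ge0 i j : 0 <= (M i j)^*%R * M i j by rewrite mulrC mul_conjC_ge0.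
move=> M0; rewrite lt_neqAle tr_dyad; apply/andP; split; last first.
  by apply: sumr_ge0 => i _; apply: sumr_ge0 => j _.
apply: contraNneq M0 => /esym/eqP.
rewrite psumr_eq0 => [/allP sM|i _]; last by apply: sumr_ge0 => j _.
apply/eqP/matrixP=> i j; rewrite mxE; have /= := sM i (mem_index_enum _).
rewrite psumr_eq0 // => /allP/(_ j (mem_index_enum _)) /=.
by rewrite mulrC mul_conjC_eq0 => /eqP.
Qed.

End Dyads.

(** * Positive semidefinite matrices *)

Section Psd.
Variables (R : realType) (n : nat).
Local Notation C := (R[i]).
Implicit Types (X Y V : 'M[C]_n).

Lemma psdD X Y : psd X -> psd Y -> psd (X + Y).
Proof.
move=> [/is_hermitianmxP hX pX] [/is_hermitianmxP hY pY]; split.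
  apply/is_hermitianmxP; move: hX hY; rewrite expr0 !scale1r => hX hY.
  by rewrite linearD map_mxD -hX -hY.
by move=> v; rewrite mulmxDr mulmxDl mxE addr_ge0.
Qed.

Lemma psd0 : psd (0 : 'M[C]_n).
Proof.
split; first by apply/is_hermitianmxP; rewrite linear0 map_mx0 scaler0.
by move=> v; rewrite mulmx0 mul0mx mxE.
Qed.

Lemma psd_conj V X : psd X -> psd (V *m X *m V ^t*).
Proof.
move=> [/is_hermitianmxP hX pX]; split.
  apply/is_hermitianmxP; move: hX; rewrite expr0 !scale1r => hX.
  by rewrite !trmxC_mul trmxCK -hX mulmxA.
move=> v; have := pX (V ^t* *m v).
by rewrite trmxC_mul trmxCK !mulmxA.
Qed.

Lemma psd_dyad d (M : 'M[C]_d) : psd (dyad M M).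
Proof.
split; first by apply/is_hermitianmxP; rewrite expr0 scale1r trmxC_mul trmxCK.
move=> v; rewrite !mulmxA -mulmxA; have -> : (vc M) ^t* *m v = (v ^t* *m vc M) ^t*.
  by rewrite trmxC_mul trmxCK.
by rewrite mxE big_ord1 !mxE mul_conjC_ge0.
Qed.

End Psd.
(** * The cone of operators of bounded Schmidt number *)

Section Cone.
Variables (C : numClosedFieldType) (d : nat).
Implicit Types (A B M N : 'M[C]_d) (X Y : 'M[C]_(d * d)).

(** Unnormalized form of [schmidt_decomposable]: nonnegative weights are absorbed into the
    matrices. *)
Definition sncone k X : Prop :=
  exists2 s : seq 'M[C]_d, all (fun M => \rank M <= k)%N s
                         & X = \sum_(M <- s) dyad M M.

Lemma sncone0 k : sncone k 0.
Proof. by exists [::]; rewrite ?big_nil. Qed.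

Lemma snconeD k X Y : sncone k X -> sncone k Y -> sncone k (X + Y).
Proof.
move=> [s sk ->] [t tk ->]; exists (s ++ t); last by rewrite big_cat.
by rewrite all_cat sk tk.
Qed.

Lemma snconeZ k c X : 0 <= c -> sncone k X -> sncone k (c *: X).
Proof.
move=> c0 [s sk ->]; exists [seq sqrtC c *: M | M <- s].
  rewrite all_map; apply: sub_all sk => M /=; apply: leq_trans.
  exact: mxrank_scale.
rewrite big_map scaler_sumr; apply: eq_bigr => M _; rewrite dyadZ.
by rewrite geC0_conj ?sqrtC_ge0 // -expr2 sqrtCK.
Qed.

Lemma sncone_sum k I (r : seq I) (P : pred I) (F : I -> 'M[C]_(d * d)) :
  (forall i, P i -> sncone k (F i)) -> sncone k (\sum_(i <- r | P i) F i).
Proof. by move=> kF; elim/big_ind: _ => //; [apply: sncone0|apply: snconeD]. Qed.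

Lemma sncone_dyad k M : (\rank M <= k)%N -> sncone k (dyad M M).
Proof. by move=> kM; exists [:: M]; rewrite ?big_seq1 //= kM. Qed.

Lemma sncone_mono k l X : (k <= l)%N -> sncone k X -> sncone l X.
Proof.
by move=> kl [s sk ->]; exists s => //; apply: sub_all sk => M /leq_trans->.
Qed.

(** Induction on [s]: adding [A i + z *: B i - z^*%R *: B' i], scaled by [c i], to [W] costs one
    unit of rank, and averaging over [z] leaves [A i] together with the dyads of [B i] and
    [B' i]. *)
Lemma phase_cone (I : Type) (A B B' : I -> 'M[C]_d) (c : I -> C) (s : seq I) r W :
  (forall i z, z * z^*%R = 1 ->
     (\rank (A i + z *: B i - z^*%R *: B' i)%R <= 1)%N) ->
  (\rank W <= r)%N ->
  sncone (r + size s)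
    (dyad (W + \sum_(i <- s) c i *: A i) (W + \sum_(i <- s) c i *: A i)
     + \sum_(i <- s) (c i * (c i)^*%R) *: (dyad (B i) (B i) + dyad (B' i) (B' i))).
Proof.
move=> A1; elim: s r W => [|i s IHs] r W Wr.
  by rewrite !big_nil !addr0 addn0; apply: sncone_dyad.
rewrite !big_cons; set T := \sum_(j <- s) c j *: A j.
set U := \sum_(j <- s) _ *: (_ + _).
(* Each of the four phases falls under the induction hypothesis with the enlarged [W]; [U] is
   counted four times, which the later factor 1/4 undoes. *)
have avg : sncone (r + size (i :: s)) (\sum_(z <- [:: 1; -1; 'i%R; - 'i%R])
    (dyad (W + c i *: (A i + z *: B i - z^*%R *: B' i) + T)
        (W + c i *: (A i + z *: B i - z^*%R *: B' i) + T) + U)).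
  rewrite big_seq; apply: sncone_sum => z zs; rewrite /= addnS -addSn.
  apply: IHs; rewrite -addn1; apply: leq_trans (mxrank_add _ _) _.
  apply: leq_add => //; apply: leq_trans (mxrank_scale _ _) _; apply: A1.
  move: zs; rewrite !inE => /or4P[]/eqP->;
    rewrite ?rmorphN ?rmorph1 /= ?conjCi ?mulrNN ?mulrN ?mulr1 ?opprK //.
    by rewrite -expr2 sqrCi opprK.
  by rewrite -expr2 sqrCi opprK.
have := @snconeZ (r + size (i :: s)) 4%:R^-1 _ _ avg; rewrite invr_ge0 ler0n.
move=> /(_ isT); congr (sncone _ _); rewrite big_split big_const_seq iter_addr_0 /=.
rewrite (eq_bigr (fun z => dyad (W + (c i *: A i + T)
      + z *: (c i *: B i) - z^*%R *: (c i *: B' i))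
    (W + (c i *: A i + T)
      + z *: (c i *: B i) - z^*%R *: (c i *: B' i)))); last first.
  move=> z _; set L := _ + T; set L' := _ - _; suff -> : L = L' by [].
  by apply/matrixP=> j k; rewrite !mxE; ring.
rewrite phase_average !dyadZ -scaler_nat -scalerDr scalerA mulVf ?pnatr_eq0 // scale1r.
by rewrite scalerDr !addrA.
Qed.

End Cone.

(** * From cone elements to states of bounded Schmidt number *)

Section ConeOfStates.
Variables (R : realType) (d : nat).
Local Notation C := (R[i]).
Implicit Types (M : 'M[C]_d) (X : 'M[C]_(d * d)).

Lemma sncone_psd k X : sncone k X -> psd X.
Proof.
move=> [s _ ->]; elim/big_ind: _ => [|U V|M _]; first exact: psd0.
  exact: psdD.
exact: psd_dyad.
Qed.

(** Null matrices are discarded since they cannot be normalized; every other dyad gets its trace as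
    weight, and these traces add up to that of [X]. *)
Lemma sncone_decomposable k X :
  sncone k X -> \tr X = 1 -> schmidt_decomposable k X.
Proof.
move=> [s sk XE] trX; pose s' := [seq M <- s | M != 0].
have {}XE : X = \sum_(l < size s') dyad s'`_l s'`_l.
  rewrite XE -(big_mkord xpredT (fun l => dyad s'`_l s'`_l)).
  rewrite -(big_nth 0 xpredT (fun M => dyad M M)) big_filter.
  rewrite [LHS](bigID (fun M => M != 0)) /= [X in _ + X]big1 ?addr0 // => M.
  by rewrite negbK => /eqP->; rewrite -(scale0r (0 : 'M_d)) dyadZ mul0r scale0r.
have s'0 (l : 'I_(size s')) : s'`_l != 0.
  by have := mem_nth 0 (ltn_ord l); rewrite mem_filter => /andP[].
pose t (l : 'I_(size s')) := \tr (dyad s'`_l s'`_l).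
have t0 l : 0 < t l by apply: tr_dyad_gt0.
have tR l : (complex.Re (t l))%:C = t l by rewrite RRe_real // gtr0_real.
have tK l : (sqrtC (t l))^-1 * ((sqrtC (t l))^-1)^*%R = (t l)^-1.
  rewrite geC0_conj ?invr_ge0 ?sqrtC_ge0 ?(ltW (t0 l)) //.
  by rewrite -invfM -expr2 sqrtCK.
have tE l : dyad ((sqrtC (t l))^-1 *: s'`_l) ((sqrtC (t l))^-1 *: s'`_l)
    = (t l)^-1 *: dyad s'`_l s'`_l by rewrite dyadZ tK.
exists (size s'), (fun l => complex.Re (t l)),
  (fun l => vc ((sqrtC (t l))^-1 *: s'`_l)); split.
- by move=> l; rewrite -lecR tR ltW.
- apply: (@complexI R); rewrite rmorph_sum /= (eq_bigr t) // -[RHS]trX XE.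
  by rewrite raddf_sum.
- move=> l; rewrite [LHS]mx11_scalar -trace_mx11.
  by rewrite mxtrace_mulC -/(dyad _ _) tE linearZ /= mulVf ?gt_eqF.
- move=> l; rewrite /schmidt_rank -/(unvc _) vcK.
  apply: leq_trans (mxrank_scale _ _) _; apply: (allP sk).
  by have := mem_nth 0 (ltn_ord l); rewrite mem_filter => /andP[].
- by rewrite XE; apply: eq_bigr => l _;
  rewrite -/(dyad _ _) tE tR scalerA mulfV ?gt_eqF // scale1r.
Qed.

End ConeOfStates.
(** * The family spanned by the identity, the flip and the symplectic projector *)

Section SymplecticForm.
Variables (R : realType) (d : nat).
Hypothesis d_even : ~~ odd d.
Local Notation C := (R[i]).
Local Notation O := (Omega R d).
Implicit Types (M N : 'M[C]_d) (X Y : 'M[C]_(d * d)).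

Lemma Omega_conj i j : (O i j)^*%R = O i j.
Proof. by rewrite mxE rmorphB /= !conjC_nat. Qed.

Lemma Omega_trC : O ^t* = O^T.
Proof. by apply/matrixP=> i j; rewrite !mxE rmorphB /= !conjC_nat. Qed.

Lemma Omega_tr : O^T = - O.
Proof. by apply/matrixP=> i j; rewrite !mxE opprB. Qed.

Lemma Omega_anti i j : O j i = - O i j.
Proof. by rewrite !mxE opprB. Qed.

Lemma Omega_sqr : O *m O = - 1%:M.
Proof.
have dE : d = (d./2 + d./2)%N by rewrite addnn even_halfK.
rewrite dE Omega_block mulmx_block !mul0mx !mulmx0 !mul1mx !mulmx1.
by rewrite !add0r !addr0 ?mulmxN ?mulmx1 [in RHS]scalar_mx_block opp_block_mx !oppr0.
Qed.

Lemma OmegaV : O *m O^T = 1%:M.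
Proof. by rewrite Omega_tr mulmxN Omega_sqr opprK. Qed.

Lemma sum_Omega_Omega a b : \sum_m O a m * O b m = (a == b)%:R.
Proof.
transitivity ((O *m O^T) a b); last by rewrite OmegaV mxE.
by rewrite mxE; apply: eq_bigr => m _; rewrite [X in _ = _ * X]mxE.
Qed.

Lemma Omega_norm : \sum_i \sum_j O i j * O i j = d%:R.
Proof.
under eq_bigr do rewrite sum_Omega_Omega eqxx.
by rewrite sumr_const card_ord.
Qed.

Lemma ket_vc (i j : 'I_d) : ket R i j = vc (delta_mx i j).
Proof.
apply/matrixP=> p q; rewrite (ord1 q); case: p / mxtens_indexP => k l.
by rewrite !mxE !mxtens_indexK /= andbT -natrM mulnb andbT.
Qed.

Lemma FlipE : Flip R d = \sum_i \sum_j dyad (delta_mx i j) (delta_mx j i).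
Proof. by apply: eq_bigr => i _; apply: eq_bigr => j _; rewrite !ket_vc. Qed.

Lemma Flip_vc M : Flip R d *m vc M = vc M^T.
Proof.
rewrite FlipE [M^T]matrix_sum_delta vc_sum mulmx_suml; apply: eq_bigr => i _.
rewrite vc_sum mulmx_suml; apply: eq_bigr => j _.
rewrite dyad_vc vcZ mxE; congr (_ *: _).
rewrite (bigD1 j) //= (bigD1 i) //= big1 => [|k ki].
  rewrite big1 => [|k kj]; first by rewrite mxE !eqxx conjC1 mul1r !addr0.
  by apply: big1 => l _; rewrite mxE (negPf kj) conjC0 mul0r.
by rewrite mxE (negPf ki) andbF conjC0 mul0r.
Qed.

Lemma Flip_entry i j k l :
  Flip R d (mxtens_index (i, j)) (mxtens_index (k, l)) = (i == l)%:R * (j == k)%:R.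
Proof.
have -> : Flip R d (mxtens_index (i, j)) (mxtens_index (k, l))
    = (Flip R d *m vc (delta_mx k l)) (mxtens_index (i, j)) 0.
  rewrite -ket_vc mxE (bigD1 (mxtens_index (k, l))) //= big1 => [|p pkl].
    by rewrite !mxE !mxtens_indexK !eqxx !mulr1 addr0.
  case: p / mxtens_indexP pkl => a b; rewrite (inj_eq (can_inj (@mxtens_indexK _ _))).
  by rewrite xpair_eqE => /negPf ab; rewrite ket_vc !mxE !mxtens_indexK /= ab mulr0.
by rewrite Flip_vc !mxE mxtens_indexK /= -natrM mulnb andbC.
Qed.

Lemma tr_Flip : \tr (Flip R d) = d%:R.
Proof.
rewrite /mxtrace sum_tens -[in RHS](card_ord d) -sumr_const; apply: eq_bigr => i _.
rewrite (bigD1 i) //= big1 => [|j ji]; rewrite Flip_entry ?eqxx ?mulr1 ?addr0 //.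
by rewrite (negPf ji) mulr0.
Qed.

(** [vc O] has squared norm [d], so [dyad O O] is [d] times an orthogonal projector. *)
Definition spmx (al be ga : C) : 'M[C]_(d * d) :=
  al *: 1%:M + be *: Flip R d + ga *: dyad O O.

Lemma spmx_vc al be ga M : spmx al be ga *m vc M
  = vc (al *: M + be *: M^T + (ga * \sum_i \sum_j O i j * M i j) *: O).
Proof.
rewrite /spmx !mulmxDl -!scalemxAl mul1mx Flip_vc dyad_vc scalerA !vcD !vcZ.
congr (_ + (_ * _) *: _); apply: eq_bigr => i _; apply: eq_bigr => j _.
by rewrite Omega_conj.
Qed.

Lemma tr_spmx al be ga : \tr (spmx al be ga) = al * d%:R ^+ 2 + (be + ga) * d%:R.
Proof.
rewrite /spmx !linearD !linearZ /= mxtrace1 tr_Flip tr_dyad natrM -expr2 mulrDl addrA.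
congr (_ + _ * _); rewrite -[RHS]Omega_norm.
by apply: eq_bigr => i _; apply: eq_bigr => j _; rewrite Omega_conj.
Qed.

Definition twist X : 'M[C]_(d * d) := IOmega R d *m X *m (IOmega R d) ^t*.

Lemma twistD X Y : twist (X + Y) = twist X + twist Y.
Proof. by rewrite /twist mulmxDr mulmxDl. Qed.

Lemma twistZ c X : twist (c *: X) = c *: twist X.
Proof. by rewrite /twist -scalemxAr -scalemxAl. Qed.

Lemma twist_dyad M N : twist (dyad M N) = dyad (M *m O^T) (N *m O^T).
Proof. by rewrite /twist tens_dyad !mul1mx. Qed.

Lemma IOmega_unitary : IOmega R d *m (IOmega R d) ^t* = 1%:M.
Proof.
apply: vc_eqP => M; rewrite -mulmxA trmxC_tens !tens_vc trmx1 map_mx1 !mul1mx.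
by rewrite Omega_trC trmxK -mulmxA OmegaV mulmx1.
Qed.

Lemma twist1 : twist 1%:M = 1%:M.
Proof. by rewrite /twist mulmx1 IOmega_unitary. Qed.

(** [IOmega] squares to minus the identity, and the sign cancels in the conjugation. *)
Lemma twist_twist X : twist (twist X) = X.
Proof.
have IO2 : IOmega R d *m IOmega R d = - 1%:M.
  apply: vc_eqP => M; rewrite -mulmxA !tens_vc !mul1mx mulNmx mul1mx -vcN -mulmxA.
  by rewrite Omega_tr mulmxN mulNmx opprK Omega_sqr mulmxN mulmx1.
have N1 : (- 1%:M : 'M[C]_(d * d)) ^t* = - 1%:M.
  by apply/matrixP=> p q; rewrite !mxE rmorphN /= conjC_nat eq_sym.
rewrite /twist !mulmxA IO2 -[LHS]mulmxA -trmxC_mul IO2 N1 mulmxN mulNmx mul1mx mulmx1.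
by rewrite opprK.
Qed.

Lemma twist_Flip_vc M : twist (Flip R d) *m vc M = vc (O *m M^T *m O).
Proof.
rewrite /twist -!mulmxA trmxC_tens tens_vc Flip_vc tens_vc trmx1 map_mx1 !mul1mx.
by rewrite Omega_trC trmxK trmx_mul Omega_tr mulmxN !mulNmx opprK !mulmxA.
Qed.

Lemma psd_twist X : psd (twist X) <-> psd X.
Proof.
by split=> [/(psd_conj (IOmega R d))|];
  [rewrite -/(twist _) twist_twist|apply: psd_conj].
Qed.

Lemma tr_twist X : \tr (twist X) = \tr X.
Proof. by rewrite /twist mxtrace_mulC mulmxA (mulmx1C IOmega_unitary) mul1mx. Qed.

Lemma quantum_state_twist X : quantum_state (twist X) <-> quantum_state X.
Proof. by rewrite /quantum_state psd_twist tr_twist. Qed.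

Lemma ptransE X i j k l :
  ptrans X (mxtens_index (i, j)) (mxtens_index (k, l))
  = X (mxtens_index (i, l)) (mxtens_index (k, j)).
Proof. by rewrite mxE !mxtens_indexK. Qed.

Lemma ptransK X : ptrans (ptrans X) = X.
Proof. by apply: tens_eqP => i j k l; rewrite !ptransE. Qed.

Lemma ptransD X Y : ptrans (X + Y) = ptrans X + ptrans Y.
Proof. by apply/matrixP=> p q; rewrite !mxE. Qed.

Lemma ptransZ c X : ptrans (c *: X) = c *: ptrans X.
Proof. by apply/matrixP=> p q; rewrite !mxE. Qed.

Lemma ptrans1 : ptrans (1%:M : 'M[C]_(d * d)) = 1%:M.
Proof.
have E1 i j k l : (1%:M : 'M[C]_(d * d)) (mxtens_index (i, j)) (mxtens_index (k, l))
    = ((i == k) && (j == l))%:R.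
  by rewrite mxE (inj_eq (can_inj (@mxtens_indexK _ _))).
by apply: tens_eqP => i j k l; rewrite ptransE !E1 (eq_sym l).
Qed.

Lemma ptrans_Flip : ptrans (Flip R d) = dyad 1%:M 1%:M.
Proof.
apply: tens_eqP => i j k l; rewrite ptransE Flip_entry dyadE !mxE conjC_nat.
by rewrite (eq_sym l).
Qed.

Lemma ptrans_dyadOmega : ptrans (dyad O O) = twist (Flip R d).
Proof.
apply: vc_eqP => M; rewrite twist_Flip_vc; apply/matrixP=> p q; rewrite (ord1 q).
case: p / mxtens_indexP => i j; rewrite mxE sum_tens.
rewrite [RHS]mxE mxtens_indexK [RHS]mxE; apply: eq_bigr => k _.
rewrite [X in _ = X * _]mxE mulr_suml; apply: eq_bigr => l _.
rewrite ptransE dyadE Omega_conj [M^T _ _]mxE [vc M _ _]mxE mxtens_indexK /=.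
by rewrite -!mulrA (mulrC (M k l)).
Qed.

(** Partial transposition sends the flip to [dyad 1 1], which is the twist of [dyad O O], and sends
    [dyad O O] to the twist of the flip. *)
Lemma ptrans_spmx al be ga : ptrans (spmx al be ga) = twist (spmx al ga be).
Proof.
rewrite /spmx !ptransD !ptransZ !twistD !twistZ ptrans1 twist1 ptrans_Flip ptrans_dyadOmega.
by rewrite twist_dyad OmegaV -!addrA (addrC (be *: _)).
Qed.

Lemma spmx_form al be ga M : M^T = - M ->
  ((vc M) ^t* *m spmx al be ga *m vc M) 0 0 =
  (al - be) * (\sum_i \sum_j (M i j)^*%R * M i j)
  + ga * (\sum_i \sum_j O i j * M i j) * (\sum_i \sum_j (M i j)^*%R * O i j).
Proof.
move=> MT; rewrite -mulmxA spmx_vc MT !vcD !vcZ vcN !mulmxDr -!scalemxAr mulmxN scalerN.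
have E (a b : C) (A B : 'M[C]_1) : (a *: A + b *: B) 0 0 = a * A 0 0 + b * B 0 0.
  by rewrite !mxE.
by rewrite -scalerBl E !vc_dot.
Qed.

(** Two alternating test vectors suffice: [O] itself, and one orthogonal to [O]. *)
Lemma psd_spmx al be ga : (4 <= d)%N -> psd (spmx al be ga) ->
  0 <= al - be /\ 0 <= al - be + ga * d%:R.
Proof.
move=> d4 [_ pos]; split; last first.
  have := pos (vc O); rewrite (@spmx_form _ _ _ O) ?Omega_tr //.
  have -> : \sum_i \sum_j (O i j)^*%R * O i j = d%:R.
    by rewrite -Omega_norm; do 2 apply: eq_bigr => ? _; rewrite Omega_conj.
  rewrite Omega_norm -mulrDl pmulr_lge0 // ltr0n.
  by apply: leq_trans d4.
have d0 : (0 < d)%N by apply: leq_trans d4.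
have d1 : (1 < d)%N by apply: leq_trans d4.
(* Indices 0 and 1 are not paired by [O] because [d./2] is at least 2, so the [M] built on them is
   orthogonal to [O]. *)
pose x := Ordinal d0; pose y := Ordinal d1.
pose M : 'M[C]_d := delta_mx x y - delta_mx y x.
have MT : M^T = - M by rewrite /M linearB /= !trmx_delta opprB.
have := pos (vc M); rewrite (@spmx_form _ _ _ M) //.
have d2 : (2 <= d./2)%N by have := half_leq d4.
have Oxy : O x y = 0.
  by rewrite mxE /= [(_ == 1)%N]gtn_eqF ?[(_ == 0)%N]gtn_eqF ?subrr // addn_gt0 ?orbT.
have sumM (F : 'I_d -> 'I_d -> C) : \sum_i \sum_j F i j * M i j = F x y - F y x.
  rewrite -!(sum_delta F) -sumrB; apply: eq_bigr => i _; rewrite -sumrB.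
  by apply: eq_bigr => j _; rewrite [M i j]mxE [X in _ * (_ + X)]mxE mulrBr.
rewrite !sumM Oxy.
rewrite Omega_anti Oxy oppr0.
rewrite subr0 mulr0 mul0r addr0.
have -> : (M x y)^*%R - (M y x)^*%R = 2%:R.
  have [xy yx] : (x == y) = false /\ (y == x) = false by [].
  by rewrite !mxE !eqxx xy yx /= subr0 sub0r rmorphN /= !conjC1 opprK.
by rewrite pmulr_lge0 ?ltr0n.
Qed.

End SymplecticForm.
(** * Decomposition of the extremal rays *)

Section MatrixUnits.
Variables (C : numClosedFieldType) (d : nat).
Local Notation E := (delta_mx : 'I_d -> 'I_d -> 'M[C]_d).

(** [Flip] over a general closed field; [FlipE] identifies the two over [R[i]]. *)
Definition flip : 'M[C]_(d * d) := \sum_i \sum_j dyad (E i j) (E j i).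
Definition diag_proj : 'M[C]_(d * d) := \sum_i dyad (E i i) (E i i).
Definition symu i j : 'M[C]_d := E i j + E j i.
Definition altu i j : 'M[C]_d := E i j - E j i.

Lemma sum_dyad_delta : \sum_i \sum_j dyad (E i j) (E i j) = 1%:M.
Proof.
apply: vc_eqP => M; rewrite mul1mx [in RHS](matrix_sum_delta M) vc_sum mulmx_suml.
apply: eq_bigr => i _; rewrite vc_sum mulmx_suml; apply: eq_bigr => j _.
rewrite dyad_vc vcZ; congr (_ *: _); rewrite -[RHS](sum_delta (fun k l => M k l)).
by apply: eq_bigr => k _; apply: eq_bigr => l _; rewrite mulrC !mxE conjC_nat.
Qed.

Lemma sum_dyad_symu : \sum_i \sum_j dyad (symu i j) (symu i j) = 2%:R *: (1%:M + flip).
Proof.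
under eq_bigr do under eq_bigr do rewrite /symu !(dyadDl, dyadDr).
under eq_bigr do rewrite !big_split; rewrite !big_split /= sum_dyad_delta -/flip.
rewrite exchange_big -/flip exchange_big sum_dyad_delta.
by rewrite scaler_nat mulr2n (addrC flip).
Qed.

Lemma sum_dyad_altu : \sum_i \sum_j dyad (altu i j) (altu i j) = 2%:R *: (1%:M - flip).
Proof.
under eq_bigr do under eq_bigr do rewrite /altu !(dyadDl, dyadDr, dyadNl, dyadNr) opprK.
under eq_bigr do rewrite !(big_split, sumrN).
rewrite !(big_split, sumrN) /= sum_dyad_delta -/flip.
rewrite exchange_big -/flip exchange_big sum_dyad_delta.
by rewrite scaler_nat mulr2n (addrC (- flip)).
Qed.

Lemma rank_delta i j : (\rank (E i j) <= 1)%N.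
Proof. by rewrite mxrank_delta. Qed.

Lemma rank_symu i j : (\rank (symu i j) <= 2)%N.
Proof. by apply: leq_trans (mxrank_add _ _) _; rewrite !mxrank_delta. Qed.

Lemma rank_altu i j : (\rank (altu i j) <= 2)%N.
Proof.
by apply: leq_trans (mxrank_add _ _) _; rewrite mxrank_opp !mxrank_delta.
Qed.

Lemma sncone_diag : sncone 1 diag_proj.
Proof. by apply: sncone_sum => i _; apply: sncone_dyad; apply: rank_delta. Qed.

Lemma sncone_offdiag : sncone 1 (1%:M - diag_proj).
Proof.
have -> : 1%:M - diag_proj = \sum_i \sum_(j | j != i) dyad (E i j) (E i j).
  rewrite -sum_dyad_delta -sumrB; apply: eq_bigr => i _.
  by rewrite (bigD1 i) //= addrC addrK.
by do 2!apply: sncone_sum => ? _; apply: sncone_dyad; apply: rank_delta.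
Qed.

(** Each [symu i i] is [2 E i i], so its dyad has weight four. Dropping these from half of the full
    sum subtracts [2 diag_proj], one copy of which is put back. *)
Lemma sncone_sym : sncone 2 (1%:M + flip - diag_proj).
Proof.
have -> : 1%:M + flip - diag_proj
    = 2%:R^-1 *: (\sum_i \sum_(j | j != i) dyad (symu i j) (symu i j)) + diag_proj.
  have lin (X Y Z : 'M[C]_(d * d)) :
      (2%:R * 2%:R) *: Z + X = 2%:R *: Y -> Y - Z = 2%:R^-1 *: X + Z.
    move=> XYZ; have -> : X = 2%:R *: Y - (2%:R * 2%:R) *: Z by rewrite -XYZ addrC addKr.
    by apply/matrixP=> p q; rewrite !mxE; field.
  have := sum_dyad_symu.
  under eq_bigr => i _.
    rewrite (bigD1 i) //= {1 2}/symu -mulr2n -scaler_nat dyadZ conjC_nat; over.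
  rewrite big_split /= -scaler_sumr -/diag_proj.
  exact: lin.
apply: snconeD; last exact: sncone_mono sncone_diag.
apply: snconeZ; first by rewrite invr_ge0 ler0n.
by do 2!apply: sncone_sum => ? _; apply: sncone_dyad; apply: rank_symu.
Qed.

End MatrixUnits.

(** * Symplectic pairs and the generators of the PPT cone *)

Section Pairs.
Variables (C : numClosedFieldType) (n : nat).
Local Notation E := (delta_mx : 'I_(n + n) -> 'I_(n + n) -> 'M[C]_(n + n)).
Local Notation flip := (flip C (n + n)).
Local Notation diag_proj := (diag_proj C (n + n)).

Definition pairu j : 'M[C]_(n + n) := altu C (lshift n j) (rshift n j).
Definition pair_proj j : 'M[C]_((n + n) * (n + n)) :=
  dyad (E (lshift n j) (lshift n j)) (E (lshift n j) (lshift n j))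
  + dyad (E (rshift n j) (rshift n j)) (E (rshift n j) (rshift n j)).
(** The symplectic form in dimension [n + n], see [Omega_pairu]. *)
Definition omegau : 'M[C]_(n + n) := \sum_j pairu j.

Lemma sum_pair_proj : \sum_j pair_proj j = diag_proj.
Proof. by rewrite big_split /diag_proj big_split_ord. Qed.

(** The two-by-two block on the pair has determinant [1 - z * z^*%R], hence is an outer product. *)
Lemma rank_phase j (z : C) : z * z^*%R = 1 ->
  (\rank (pairu j + z *: E (lshift n j) (lshift n j)
          - z^*%R *: E (rshift n j) (rshift n j))%R <= 1)%N.
Proof.
move=> z1; set l := lshift n j; set r := rshift n j.
have -> : pairu j + z *: E l l - z^*%R *: E r r
   = (z *: delta_mx l 0 - delta_mx r 0 : 'cV_(n + n))
     *m (delta_mx 0 l + z^*%R *: delta_mx 0 r).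
  rewrite mulmxDl !mulmxDr mulNmx mulNmx -!scalemxAr -!scalemxAl !mul_delta_mx.
  rewrite scalerA (mulrC _ z) z1 scale1r /pairu /altu -/l -/r.
  move: (E l r) (E r l) (E l l) (E r r) => A1 A2 A3 A4.
  by apply/matrixP=> p q; rewrite !mxE; ring.
exact: leq_trans (mxrankM_maxl _ _) (rank_leq_col _).
Qed.

(** [phase_cone] over all [n] pairs, started at the zero matrix: one unit of rank per pair, although
    [omegau] itself has rank [2 n]. *)
Lemma sncone_omegau : sncone n (dyad omegau omegau + diag_proj).
Proof.
have := @phase_cone C (n + n) 'I_n pairu _ _ (fun _ => 1) (enum 'I_n) 0 0 rank_phase.
rewrite mxrank0 => /(_ isT); rewrite size_enum_ord add0n add0r !big_enum /=.
under eq_bigr do rewrite scale1r; rewrite -/omegau.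
by under [X in _ + X]eq_bigr do rewrite conjC1 mulr1 scale1r; rewrite -sum_pair_proj.
Qed.

Lemma sncone_pair j k : j != k ->
  sncone 2 (dyad (pairu j - pairu k) (pairu j - pairu k) + (pair_proj j + pair_proj k)).
Proof.
move=> jk; pose c i : C := if i == j then 1 else -1.
have := @phase_cone C (n + n) 'I_n pairu _ _ c [:: j; k] 0 0 rank_phase.
rewrite mxrank0 => /(_ isT); rewrite !big_cons !big_nil /c eqxx (eq_sym k) (negPf jk).
by rewrite add0r !addr0 rmorphN /= !conjC1 mulrNN mulr1 !scale1r scaleN1r.
Qed.

Lemma sum_sub_pairu :
  \sum_j \sum_k dyad (pairu j - pairu k) (pairu j - pairu k)
  = (2 * n)%:R *: (\sum_j dyad (pairu j) (pairu j)) - 2%:R *: dyad omegau omegau.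
Proof.
set S := \sum_j dyad (pairu j) (pairu j).
have expand j k : dyad (pairu j - pairu k) (pairu j - pairu k)
    = (dyad (pairu j) (pairu j) + dyad (pairu k) (pairu k))
      - (dyad (pairu j) (pairu k) + dyad (pairu k) (pairu j)).
  rewrite !(dyadDl, dyadDr, dyadNl, dyadNr) opprK.
  move: (dyad _ _) (dyad _ _) (dyad _ _) (dyad _ _) => X1 X2 X3 X4.
  by apply/matrixP=> p q; rewrite !mxE; ring.
have inner j : \sum_k dyad (pairu j - pairu k) (pairu j - pairu k)
    = dyad (pairu j) (pairu j) *+ n + S - (dyad (pairu j) omegau + dyad omegau (pairu j)).
  under eq_bigr do rewrite expand.
  by rewrite sumrB !big_split /= sumr_const card_ord dyad_sumr dyad_suml.
under eq_bigr do rewrite inner.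
rewrite sumrB !big_split /= sumrMnl sumr_const card_ord -dyad_suml -dyad_sumr.
by rewrite !scaler_nat mul2n -addnn mulrnDr mulr2n.
Qed.

(** Half the sum of [sncone_pair] over ordered pairs of distinct indices, in which every
    [pair_proj j] ends up with weight [n - 1]. *)
Lemma sncone_pairs : sncone 2
  (n%:R *: (\sum_j dyad (pairu j) (pairu j)) - dyad omegau omegau
   + (n%:R - 1) *: diag_proj).
Proof.
have -> : n%:R *: (\sum_j dyad (pairu j) (pairu j)) - dyad omegau omegau
     + (n%:R - 1) *: diag_proj
   = 2%:R^-1 *: (\sum_j \sum_(k | j != k)
       (dyad (pairu j - pairu k) (pairu j - pairu k) + (pair_proj j + pair_proj k))).
  have all_pairs : \sum_j \sum_k
       (dyad (pairu j - pairu k) (pairu j - pairu k) + (pair_proj j + pair_proj k))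
     = (2 * n)%:R *: (\sum_j dyad (pairu j) (pairu j)) - 2%:R *: dyad omegau omegau
       + (2 * n)%:R *: diag_proj.
    under eq_bigr do rewrite big_split; rewrite big_split /= sum_sub_pairu.
    congr (_ + _); under eq_bigr do rewrite big_split sumr_const card_ord /= sum_pair_proj.
    rewrite big_split /= sumr_const card_ord sumrMnl sum_pair_proj.
    by rewrite scaler_nat mul2n -addnn mulrnDr.
  have diag : \sum_j \sum_k
       (dyad (pairu j - pairu k) (pairu j - pairu k) + (pair_proj j + pair_proj k))
     = 2%:R *: diag_proj + \sum_j \sum_(k | j != k)
       (dyad (pairu j - pairu k) (pairu j - pairu k) + (pair_proj j + pair_proj k)).
    rewrite -sum_pair_proj scaler_sumr -big_split; apply: eq_bigr => j _.
    rewrite (bigD1 j) //= subrr -[X in dyad X X](scale0r 0) dyadZ mul0r scale0r add0r.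
    by rewrite -mulr2n -scaler_nat; congr (_ + _); apply: eq_bigl => k; rewrite eq_sym.
  have lin (X Y Z W : 'M[C]_((n + n) * (n + n))) :
      2%:R *: W + X = (2 * n)%:R *: Y - 2%:R *: Z + (2 * n)%:R *: W ->
      n%:R *: Y - Z + (n%:R - 1) *: W = 2%:R^-1 *: X.
    move=> XE; have -> : X = (2 * n)%:R *: Y - 2%:R *: Z + (2 * n)%:R *: W - 2%:R *: W.
      by rewrite -XE addrC addKr.
    by apply/matrixP=> p q; rewrite !mxE natrM; field.
  by apply: lin; rewrite -diag.
apply: snconeZ; first by rewrite invr_ge0 ler0n.
by do 2!apply: sncone_sum => ? ?; apply: sncone_pair.
Qed.

(** The alternating units other than the [pairu j]. Those joining the two halves occur twice in the
    full sum, hence without the factor one half. *)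
Lemma sncone_alt : sncone 2 (1%:M - flip - \sum_j dyad (pairu j) (pairu j)).
Proof.
have altN i j : dyad (altu C i j) (altu C i j) = dyad (altu C j i) (altu C j i).
  by rewrite /altu -opprB dyadNl dyadNr opprK.
pose l := @lshift n n; pose r := @rshift n n.
have -> : 1%:M - flip - \sum_j dyad (pairu j) (pairu j) = 2%:R^-1 *:
   (\sum_j \sum_k dyad (altu C (l j) (l k)) (altu C (l j) (l k))
    + \sum_j \sum_k dyad (altu C (r j) (r k)) (altu C (r j) (r k)))
   + \sum_j \sum_(k | k != j) dyad (altu C (l j) (r k)) (altu C (l j) (r k)).
  have := sum_dyad_altu C (n + n); rewrite big_split_ord /=.
  under eq_bigr do rewrite big_split_ord; rewrite big_split /=.
  under [X in _ + X]eq_bigr do rewrite big_split_ord; rewrite [X in _ + X]big_split /=.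
  have -> : \sum_i \sum_i0 dyad (altu C (rshift n i) (lshift n i0))
                                (altu C (rshift n i) (lshift n i0))
     = \sum_i \sum_i0 dyad (altu C (l i) (r i0)) (altu C (l i) (r i0)).
    by rewrite exchange_big; do 2 apply: eq_bigr => ? _; rewrite altN.
  have -> : \sum_i \sum_i0 dyad (altu C (l i) (r i0)) (altu C (l i) (r i0))
     = \sum_j dyad (pairu j) (pairu j)
       + \sum_j \sum_(k | k != j) dyad (altu C (l j) (r k)) (altu C (l j) (r k)).
    by rewrite -big_split; apply: eq_bigr => j _; rewrite (bigD1 j).
  have lin (X X1 X2 X3 X4 : 'M[C]_((n + n) * (n + n))) :
      X3 + (X1 + X2) + (X1 + X2 + X4) = 2%:R *: X ->
      X - X1 = 2%:R^-1 *: (X3 + X4) + X2.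
    move=> XE; have -> : X = 2%:R^-1 *: (X3 + (X1 + X2) + (X1 + X2 + X4)).
      by rewrite XE scalerA mulVf ?pnatr_eq0 // scale1r.
    by apply/matrixP=> p q; rewrite !mxE; field.
  exact: lin.
apply: snconeD.
  apply: snconeZ; first by rewrite invr_ge0 ler0n.
  by apply: snconeD; do 2!apply: sncone_sum => ? _; apply: sncone_dyad; apply: rank_altu.
by do 2!apply: sncone_sum => ? _; apply: sncone_dyad; apply: rank_altu.
Qed.

(** Every point of the cone is a nonnegative combination of [g1], [g4] and one of [g2], [g3],
    according to the order of [be] and [ga]. *)
Lemma sncone_spmx (al be ga : C) : (2 <= n)%N ->
  0 <= al - be -> 0 <= al - be + ga * (n + n)%:R ->
  0 <= al - ga -> 0 <= al - ga + be * (n + n)%:R ->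
  sncone n (al *: 1%:M + be *: flip + ga *: dyad omegau omegau).
Proof.
move=> n2 h1 h2 h3 h4.
have n0 : (n + n)%:R != 0 :> C by rewrite pnatr_eq0; lia.
have npos : 0 <= (n + n)%:R^-1 :> C by rewrite invr_ge0 ler0n.
have n1 : 0 <= n%:R - 1 :> C by rewrite subr_ge0 ler1n; lia.
have sum_eq (k : nat) (X Y Z : 'M[C]_((n + n) * (n + n))) :
    sncone k X -> sncone k Y -> X + Y = Z -> sncone k Z.
  by move=> kX kY <-; apply: snconeD.
pose I1 : 'M[C]_((n + n) * (n + n)) := 1%:M.
have Sym : sncone n (I1 + flip - diag_proj) := sncone_mono n2 (sncone_sym _ _).
have Diag : sncone n diag_proj.
  by apply: sncone_mono (sncone_diag _ _); apply: leq_trans n2.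
have Off : sncone n (I1 - diag_proj).
  by apply: sncone_mono (sncone_offdiag _ _); apply: leq_trans n2.
have g1 : sncone n (I1 + flip + dyad omegau omegau).
  by apply: sum_eq Sym sncone_omegau _; rewrite addrA [LHS]addrAC subrK.
have g2 : sncone n (I1 + flip) by apply: sum_eq Sym Diag _; rewrite subrK.
have g3 : sncone n (I1 + dyad omegau omegau).
  by apply: sum_eq Off sncone_omegau _; rewrite addrA [LHS]addrAC subrK.
(* [n] times [sncone_alt], plus [sncone_pairs], plus [n - 1] times [Sym]: the pair dyads and the
   diagonal cancel. *)
have g4 : sncone n (((n + n)%:R - 1) *: I1 - flip - dyad omegau omegau).
  apply: (@sum_eq _ _ (n%:R *: (1%:M - flip - \sum_j dyad (pairu j) (pairu j)))).
  - by apply: snconeD (sncone_mono n2 sncone_pairs) (snconeZ n1 Sym).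
  - by apply: snconeZ (sncone_mono n2 sncone_alt); rewrite ler0n.
  rewrite -/I1; generalize I1 flip diag_proj (dyad omegau omegau) 
    (\sum_j dyad (pairu j) (pairu j)) => X Y Z U V.
  by apply/matrixP=> p q; rewrite !mxE natrD; ring.
have npos' : 0 < (n + n)%:R :> C by rewrite lt0r n0 ler0n.
have comb (x1 x2 x4 : C) X : sncone n X -> 0 <= x1 -> 0 <= x2 -> 0 <= x4 ->
    sncone n (x1 *: (I1 + flip + dyad omegau omegau) + x2 *: X
              + x4 *: (((n + n)%:R - 1) *: I1 - flip - dyad omegau omegau)).
  by move=> kX x10 x20 x40; do 2?apply: snconeD; apply: snconeZ.
(* The order of [C] is partial; [be] and [ga] are comparable because [be - ga] is a difference of
   nonnegative numbers. *)
have /orP[le|le] : (ga <= be) || (be <= ga).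
  rewrite -(subr_ge0 ga be) -(subr_le0 ga be) -realE.
  have -> : be - ga = (al - ga) - (al - be) by ring.
  by apply: realB; apply: ger0_real.
- have := @comb ((al - be + ga * (n + n)%:R) / (n + n)%:R) (be - ga)
    ((al - be) / (n + n)%:R) _ g2.
  rewrite subr_ge0 !mulr_ge0 // => /(_ isT le isT); congr sncone.
  rewrite -/I1; generalize I1 flip (dyad omegau omegau) => X Y Z.
  by apply/matrixP=> p q; rewrite !mxE; move: ((n + n)%:R) n0 => N N0; field.
- have := @comb ((al - ga + be * (n + n)%:R) / (n + n)%:R) (ga - be)
    ((al - ga) / (n + n)%:R) _ g3.
  rewrite subr_ge0 !mulr_ge0 // => /(_ isT le isT); congr sncone.
  rewrite -/I1; generalize I1 flip (dyad omegau omegau) => X Y Z.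
  by apply/matrixP=> p q; rewrite !mxE; move: ((n + n)%:R) n0 => N N0; field.
Qed.

End Pairs.
(** * Symplectic invariant tensors *)

Section InvariantTensors.
Variables (C : numClosedFieldType) (d : nat) (O : 'M[C]_d).
Hypotheses (O_anti : forall i j, O j i = - O i j)
  (O_orth : forall i j, \sum_m O i m * O j m = (i == j)%:R).

Implicit Types (k : 'I_d -> 'I_d -> C) (y : 'I_d -> 'I_d -> 'I_d -> 'I_d -> C).

(** Infinitesimal invariance: each slot in turn is hit by the symplectic generator whose entries are
    computed in [trv2E]. *)
Definition invariant2 k := forall m l a b,
  O m a * k l b + O l a * k m b + O m b * k a l + O l b * k a m = 0.

Definition invariant4 y := forall m l a b c e,
  (O m a * y l b c e + O l a * y m b c e) + (O m b * y a l c e + O l b * y a m c e)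
  + (O m c * y a b l e + O l c * y a b m e)
  + (O m e * y a b c l + O l e * y a b c m) = 0.

(** The indices of [k] are reversed, so the contraction of [O] itself is [- d]; this fixes the signs
    below. *)
Definition contract k : C := \sum_m \sum_a O m a * k a m.

Lemma contract_delta (f : 'I_d -> C) i : \sum_m (m == i)%:R * f m = f i.
Proof.
rewrite (bigD1 i) //= eqxx mul1r big1 ?addr0 // => m /negPf->.
by rewrite mul0r.
Qed.

Lemma contract_left (f : 'I_d -> C) i : \sum_m \sum_a O m a * (O m i * f a) = f i.
Proof.
rewrite exchange_big -[RHS]contract_delta; apply: eq_bigr => a _.
under eq_bigr do rewrite mulrA; rewrite -mulr_suml -O_orth; congr (_ * _).
by apply: eq_bigr => m _; rewrite (O_anti a) (O_anti i) mulrNN.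
Qed.

Lemma contract_right (f : 'I_d -> C) i : \sum_m \sum_a O m a * (O i a * f m) = f i.
Proof.
rewrite -[RHS]contract_delta; apply: eq_bigr => a _.
by under eq_bigr do rewrite mulrA; rewrite -mulr_suml O_orth.
Qed.

Lemma contract_scale x k : \sum_m \sum_a O m a * (x * k a m) = x * contract k.
Proof.
rewrite mulr_sumr; apply: eq_bigr => m _; rewrite mulr_sumr; apply: eq_bigr => a _.
by rewrite mulrCA.
Qed.

Lemma contract_norm z : \sum_m \sum_a O m a * (O m a * z) = d%:R * z.
Proof.
under eq_bigr do under eq_bigr do rewrite mulrA.
under eq_bigr do rewrite -mulr_suml O_orth eqxx mul1r.
by rewrite sumr_const card_ord mulr_natl.
Qed.

Lemma casimir2 k a b : invariant2 k ->
  (d%:R + 1) * k a b + k b a + O a b * contract k = 0.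
Proof.
move=> inv; have : \sum_m \sum_c O m c * 0 = 0 :> C.
  by rewrite big1 // => m _; rewrite big1 // => c _; rewrite mulr0.
under eq_bigr => m _ do under eq_bigr => c _ do rewrite -(inv m a c b) !mulrDr.
under eq_bigr do rewrite !big_split; rewrite !big_split /=.
rewrite contract_norm (contract_right (k^~ b)) (contract_left (k^~ a)) contract_scale.
by rewrite mulrDl mul1r.
Qed.

(** The Casimir identities at [(a, b)] and [(b, a)] add up to [(d + 2) (k a b + k b a) = 0], so [k]
    is alternating; the identity then reads [d k a b = - O a b contract k]. *)
Lemma invariant2_scalar k : (0 < d)%N -> invariant2 k ->
  exists z, forall a b, k a b = z * O a b.
Proof.
move=> d0 inv; exists (- contract k / d%:R) => a b.
have d_neq0 : d%:R != 0 :> C by rewrite pnatr_eq0 -lt0n.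
have d2_neq0 : d%:R + 2%:R != 0 :> C by rewrite -natrD pnatr_eq0 addn2.
have eab := casimir2 a b inv; have eba := casimir2 b a inv.
have sym : k b a = - k a b.
  apply/eqP; rewrite -subr_eq0 opprK; apply/eqP; apply: (mulfI d2_neq0).
  rewrite mulr0 -[RHS](addr0 0) -{1}eab -eba (O_anti a b); ring.
apply: (mulfI d_neq0); rewrite sym in eab.
transitivity (- (O a b * contract k)); last by field.
by apply/eqP; rewrite -subr_eq0 opprK -eab; apply/eqP; ring.
Qed.

(** As [O] is itself invariant, the terms acting on the two contracted slots cancel. *)
Lemma contract_invariant y : invariant4 y ->
  invariant2 (fun c e => contract (fun a b => y a b c e)).
Proof.
move=> inv m l c e; have : \sum_b \sum_a O b a * 0 = 0 :> C.
  by rewrite big1 // => ? _; rewrite big1 // => ? _; rewrite mulr0.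
under eq_bigr => b _ do under eq_bigr => a _ do rewrite -(inv m l a b c e) !mulrDr.
under eq_bigr do rewrite !big_split; rewrite !big_split /= !contract_scale.
rewrite !(contract_right (fun b => y _ b c e)) => <-.
have flipO x z : \sum_b \sum_a O b a * (O x b * y a z c e) = - y x z c e.
  rewrite -(contract_left (fun a => y a z c e)) -sumrN; apply: eq_bigr => b _.
  by rewrite -sumrN; apply: eq_bigr => a _; rewrite (O_anti b x); ring.
by rewrite !flipO; ring.
Qed.

(* Apply the invariance relation with [l = a], multiply by [O m p] and sum over the
   matrix unit [m p]: this contracts the action of the Casimir element. *)
Lemma casimir4 y a b c e : invariant4 y ->
  (d%:R + 1) * y a b c e + y b a c e + y c b a e + y e b c a
  + O a b * contract (fun p q => y p q c e) + O a c * contract (fun p q => y p b q e)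
  + O a e * contract (fun p q => y p b c q) = 0.
Proof.
move=> inv; have : \sum_m \sum_p O m p * 0 = 0 :> C.
  by rewrite big1 // => ? _; rewrite big1 // => ? _; rewrite mulr0.
under eq_bigr => m _ do under eq_bigr => p _ do rewrite -(inv m a p b c e) !mulrDr.
under eq_bigr do rewrite !big_split; rewrite !big_split /=.
rewrite contract_norm (contract_right (fun m => y m b c e)).
rewrite (contract_left (fun p => y p a c e)) (contract_left (fun p => y p b a e)).
rewrite (contract_left (fun p => y p b c a)).
rewrite (contract_scale _ (fun p q => y p q c e)) (contract_scale _ (fun p q => y p b q e)).
rewrite (contract_scale _ (fun p q => y p b c q)) => <-; ring.
Qed.

(* Compare l1 norms: a transposition of the arguments preserves them and [3 < d + 1]. *)
Lemma transposition_sum_inj y : (2 < d)%N ->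
  (forall a b c e, (d%:R + 1) * y a b c e + y b a c e + y c b a e + y e b c a = 0) ->
  forall a b c e, y a b c e = 0.
Proof.
move=> d2 eqy; pose T := \sum_a \sum_b \sum_c \sum_e `|y a b c e|.
have nneg a b c : 0 <= \sum_e `|y a b c e| by apply: sumr_ge0.
have nneg2 a b : 0 <= \sum_c \sum_e `|y a b c e| by apply: sumr_ge0.
have nneg3 a : 0 <= \sum_b \sum_c \sum_e `|y a b c e| by apply: sumr_ge0.
have T0 : 0 <= T by apply: sumr_ge0.
have T1 : \sum_a \sum_b \sum_c \sum_e `|y b a c e| = T by rewrite exchange_big.
have T2 : \sum_a \sum_b \sum_c \sum_e `|y c b a e| = T.
  rewrite exchange_big /T [RHS]exchange_big /=; apply: eq_bigr => b _.
  by rewrite exchange_big.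
have T3 : \sum_a \sum_b \sum_c \sum_e `|y e b c a| = T.
  rewrite exchange_big /T [RHS]exchange_big /=; apply: eq_bigr => b _.
  rewrite exchange_big [RHS]exchange_big /=; apply: eq_bigr => c _.
  by rewrite exchange_big.
have dT : (d%:R + 1) * T <= 3%:R * T.
  have -> : 3%:R * T = T + T + T by ring.
  rewrite -[X in _ <= X + _ + _]T1 -[X in _ <= _ + X + _]T2 -[X in _ <= _ + X]T3.
  rewrite /T mulr_sumr -!big_split; apply: ler_sum => a _.
  rewrite mulr_sumr -!big_split; apply: ler_sum => b _.
  rewrite mulr_sumr -!big_split; apply: ler_sum => c _.
  rewrite mulr_sumr -!big_split; apply: ler_sum => e _ /=.
  have -> : (d%:R + 1) * `|y a b c e| = `|y b a c e + y c b a e + y e b c a|.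
    rewrite -[d%:R + 1]ger0_norm ?addr_ge0 ?ler0n ?ler01 // -normrM -normrN.
    congr `|_|; apply/eqP; rewrite -subr_eq0 -oppr_eq0 opprB opprK.
    rewrite -(eqy a b c e); apply/eqP; ring.
  by apply: le_trans (ler_normD _ _) _; rewrite lerD2r ler_normD.
have {dT} T_eq0 : T = 0.
  apply/eqP; rewrite eq_le T0 andbT.
  have d_pos : 0 < d%:R - 2%:R :> C by rewrite subr_gt0 ltr_nat.
  rewrite -(pmulr_rle0 _ d_pos); rewrite -subr_le0 in dT.
  by congr (_ <= 0): dT; ring.
move=> a b c e; apply/eqP; rewrite -normr_le0 -T_eq0 /T.
rewrite (bigD1 a) //= (bigD1 b) //= (bigD1 c) //= (bigD1 e) //= -!addrA lerDl.
by rewrite !addr_ge0 ?sumr_ge0 // => *; rewrite ?sumr_ge0.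
Qed.

(** Contracting the first slot with each other slot gives multiples of [O]. Subtracting a suitable
    combination of forms from [y] leaves a solution of the homogeneous Casimir identity, which
    vanishes. *)
Lemma invariant4_forms y : (2 < d)%N -> invariant4 y ->
  exists al be ga, forall a b c e,
    y a b c e = al * (O a c * O b e) + be * (O a e * O b c) + ga * (O a b * O c e).
Proof.
move=> d2 inv; have d0 : (0 < d)%N by apply: leq_trans d2.
have inv3 : invariant4 (fun a b c e => y a c b e).
  by move=> m l a b c e; rewrite -(inv m l a c b e); ring.
have inv4 : invariant4 (fun a b c e => y a c e b).
  by move=> m l a b c e; rewrite -(inv m l a c e b); ring.
have [r3 K12] := invariant2_scalar d0 (contract_invariant inv).
have [r1 K13] := invariant2_scalar d0 (contract_invariant inv3).
have [r2 K14] := invariant2_scalar d0 (contract_invariant inv4).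
have den1 : d%:R - 2%:R != 0 :> C by rewrite subr_eq0 eqr_nat gtn_eqF.
have den2 : d%:R + 1 != 0 :> C by rewrite natr1 pnatr_eq0.
(* The coefficients come from inverting the Casimir operator on the span of the three products of
   forms; [d > 2] keeps [D] nonzero. *)
pose D : C := (d%:R - 2%:R) * (d%:R + 1).
exists ((r2 + r3 - (d%:R - 1) * r1) / D), ((r1 - (d%:R - 1) * r2 - r3) / D),
  ((r1 - r2 - (d%:R - 1) * r3) / D) => a b c e.
apply/eqP; rewrite -subr_eq0; apply/eqP; move: a b c e.
apply: (transposition_sum_inj d2 (y := fun a b c e => _)) => a b c e.
have := casimir4 a b c e inv; rewrite K12 K13 K14 => E.
rewrite -[RHS]E (O_anti a b) (O_anti a c) (O_anti a e) (O_anti b c) (O_anti b e).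
rewrite (O_anti c e) /D; field.
by rewrite den1 den2.
Qed.

End InvariantTensors.
(** * The commutant of the symplectic group *)

Section Commutant.
Variables (C : numClosedFieldType) (d : nat) (O : 'M[C]_d).
Hypotheses (OT : O^T = - O) (OO : O *m O = - 1%:M) (OC : O ^t* = O^T).
Variable X : 'M[C]_(d * d).
Hypothesis X_comm : forall S : 'M[C]_d, S \is unitarymx -> S^T *m O *m S = O ->
  (S *t S) *m X = X *m (S *t S).

Implicit Types (A B N M : 'M[C]_d) (u : 'cV[C]_d).

Definition deriv_tens A : 'M[C]_(d * d) := A *t 1%:M + 1%:M *t A.

Lemma tensDl A B M : (A + B) *t M = A *t M + B *t M.
Proof. by apply/matrixP=> p q; rewrite !mxE mulrDl. Qed.

Lemma tensDr A B M : M *t (A + B) = M *t A + M *t B.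
Proof. by apply/matrixP=> p q; rewrite !mxE mulrDr. Qed.

Lemma tensZl c A M : (c *: A) *t M = c *: (A *t M).
Proof. by apply/matrixP=> p q; rewrite !mxE mulrA. Qed.

Lemma tensZr c A M : M *t (c *: A) = c *: (M *t A).
Proof. by apply/matrixP=> p q; rewrite !mxE mulrCA. Qed.

Lemma deriv_tensD A B : deriv_tens (A + B) = deriv_tens A + deriv_tens B.
Proof. by rewrite /deriv_tens tensDl tensDr addrACA. Qed.

Lemma deriv_tensZ c A : deriv_tens (c *: A) = c *: deriv_tens A.
Proof. by rewrite /deriv_tens tensZl tensZr scalerDr. Qed.

Definition comX (Z : 'M[C]_(d * d)) : Prop := Z *m X = X *m Z.

Lemma comXD Z W : comX Z -> comX W -> comX (Z + W).
Proof. by rewrite /comX mulmxDl mulmxDr => -> ->. Qed.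

Lemma comXZ c Z : comX Z -> comX (c *: Z).
Proof. by rewrite /comX -scalemxAl -scalemxAr => ->. Qed.

(* The exponential of [t A] for [(c, s) = (cos t, sin t)] when [A^3 = - A]. *)
Definition rot A (c s : C) : 'M[C]_d := 1%:M + s *: A + (1 - c) *: (A *m A).

(** [rot A c (- s)] is both the adjoint and the inverse of [rot A c s], and [A] is skew for [O], so
    the rotation lies in the group. *)
Lemma rot_tens A c s : s^*%R = s -> c^*%R = c -> s ^+ 2 + c ^+ 2 = 1 ->
  A ^t* = - A -> A *m A *m A = - A -> A^T *m O = - (O *m A) ->
  comX (rot A c s *t rot A c s).
Proof.
move=> sR cR sc AC A3 AO.
have A4 : A *m A *m (A *m A) = - (A *m A) by rewrite mulmxA A3 mulNmx.
have A3' : A *m (A *m A) = - A by rewrite mulmxA.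
have rotC : (rot A c s) ^t* = rot A c (- s).
  rewrite /rot !linearD !linearZ /= !map_mxD !map_mxZ trmx1 map_mx1 trmxC_mul AC /=.
  by rewrite mulmxN mulNmx opprK rmorphB /= conjC1 sR cR scalerN scaleNr.
have rotM : rot A c s *m rot A c (- s) = 1%:M.
  rewrite /rot !mulmxDl !mulmxDr !mul1mx !mulmx1 -!scalemxAl -!scalemxAr A4 A3 A3'.
  have c2 : c ^+ 2 = 1 - s ^+ 2 by rewrite -sc addrC addKr.
  move: (A *m A) => B; apply/matrixP=> p q; rewrite !mxE.
  by ring: c2.
have rotU : rot A c s \is unitarymx by apply/unitarymxP; rewrite rotC.
apply: X_comm => //.
have -> : (rot A c s)^T *m O = O *m rot A c (- s).
  have AAO : A^T *m A^T *m O = O *m (A *m A).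
    by rewrite -mulmxA AO mulmxN [A^T *m _]mulmxA AO mulNmx opprK mulmxA.
  rewrite /rot !linearD !linearZ /= trmx1 trmx_mul !mulmxDl mul1mx mulmx1.
  by rewrite -!scalemxAl AO AAO scalerN scaleNr.
by rewrite -mulmxA (mulmx1C rotM) mulmx1.
Qed.

(* The part of [rot A c s *t rot A c s] odd in [s], taken for [c = 0] and [c = 3/5],
   isolates the derivation. *)
Lemma comX_deriv A : A ^t* = - A -> A *m A *m A = - A -> A^T *m O = - (O *m A) ->
  comX (deriv_tens A).
Proof.
move=> AC A3 AO; set B := A *m A.
pose P c : 'M[C]_d := 1%:M + (1 - c) *: B.
have odd_part c s : s^*%R = s -> c^*%R = c -> s ^+ 2 + c ^+ 2 = 1 -> s != 0 ->
    comX (P c *t A + A *t P c).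
  move=> sR cR sc s0.
  have -> : P c *t A + A *t P c = (2%:R * s)^-1 *:
      (rot A c s *t rot A c s + (-1) *: (rot A c (- s) *t rot A c (- s))).
    have rE t : rot A c t = t *: A + P c by rewrite /rot /P addrAC addrC.
    rewrite !rE !(tensDl, tensDr, tensZl, tensZr).
    move: (A *t A) (A *t P c) (P c *t A) (P c *t P c) => Y1 Y2 Y3 Y4.
    by apply/matrixP=> p q; rewrite !mxE; field.
  apply/comXZ/comXD; first exact: rot_tens.
  by apply: comXZ; apply: rot_tens => //; rewrite ?rmorphN /= ?sR ?sqrrN.
have r5 (a : nat) : (a%:R / 5%:R : C)^*%R = a%:R / 5%:R.
  by rewrite rmorphM /= fmorphV /= !conjC_nat.
have odd0 := @odd_part 0 1 (conjC1 _) (conjC0 _) _ (oner_neq0 _).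
have odd35 := @odd_part (3%:R / 5%:R) (4%:R / 5%:R) (r5 4%N) (r5 3%N) _ _.
(* The triple 3, 4, 5 keeps the sine rational. The weights 5/3 and -2/3 add up to 1 and cancel the
   [B] terms, whose coefficients are 2/5 and 1. *)
have -> : deriv_tens A = (5%:R / 3%:R) *: (P (3%:R / 5%:R) *t A + A *t P (3%:R / 5%:R))
    + (- (2%:R / 3%:R)) *: (P 0 *t A + A *t P 0).
  rewrite /deriv_tens /P !(tensDl, tensDr, tensZl, tensZr).
  move: (A *t 1%:M) (1%:M *t A) (B *t A) (A *t B) => Y1 Y2 Y3 Y4.
  by apply/matrixP=> p q; rewrite !mxE; field.
apply: comXD; apply: comXZ; [apply: odd35|apply: odd0].
- by field.
- by rewrite mulf_neq0 ?invr_eq0 ?pnatr_eq0.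
- by rewrite expr1n expr0n addr0.
Qed.

(** The infinitesimal symplectic transvection [v |-> (u^T O v) u]. *)
Definition trv u : 'M[C]_d := u *m u^T *m O.

Lemma trvZ c u : trv (c *: u) = (c ^+ 2) *: trv u.
Proof. by rewrite /trv linearZ /= -!scalemxAl -scalemxAr -scalemxAl scalerA. Qed.

Lemma form_alt u : u^T *m O *m u = 0.
Proof.
have E : (u^T *m O *m u)^T = - (u^T *m O *m u).
  by rewrite !trmx_mul trmxK OT mulNmx mulmxN mulmxA.
apply/matrixP=> i j; rewrite !ord1; have := congr1 (fun M : 'M_1 => M 0 0) E.
rewrite !mxE => /eqP; rewrite -subr_eq0 opprK -mulr2n -mulr_natl mulf_eq0 pnatr_eq0 /=.
by move/eqP.
Qed.

Lemma trv_form u : (trv u)^T *m O = - (O *m trv u).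
Proof. by rewrite /trv !trmx_mul trmxK OT mulNmx mulmxA mulNmx !mulmxA. Qed.

Lemma trvC u : (trv u) ^t* = - (O *m (u^T) ^t* *m u ^t*).
Proof.
by rewrite /trv !trmxC_mul OC OT mulNmx mulmxA.
Qed.

(* For a unit vector [N = trv u] satisfies [N^2 = 0] and [N N^* N = N], so that
   [N - N^*] exponentiates to [rot]; a phase on [u] then separates [N] from [N^*]. *)
Lemma comX_trv_unit u : u ^t* *m u = 1%:M -> comX (deriv_tens (trv u)).
Proof.
move=> u1.
have skew v : v ^t* *m v = 1%:M -> comX (deriv_tens (trv v - (trv v) ^t*)).
  move=> v1; set N := trv v; set N' := N ^t*.
  have N2 : N *m N = 0.
    have -> : N *m N = v *m (v^T *m O *m v) *m (v^T *m O) by rewrite /N /trv !mulmxA.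
    by rewrite form_alt mulmx0 mul0mx.
  have N'2 : N' *m N' = 0 by rewrite -trmxC_mul N2 linear0 map_mx0.
  have vv : v^T *m (v^T) ^t* = 1%:M.
    by have := congr1 trmx v1; rewrite trmx_mul trmx1 map_trmx.
  have NN' : N *m N' = v *m v ^t*.
    rewrite /N' trvC mulmxN /N /trv !mulmxA -(mulmxA _ O O) OO mulmxN mulmx1 !mulNmx.
    by rewrite opprK -(mulmxA v) vv mulmx1.
  have NN'N : N *m N' *m N = N.
    by rewrite NN' /N /trv !mulmxA -(mulmxA v) v1 mulmx1.
  have N'NN' : N' *m N *m N' = N'.
    by rewrite -mulmxA -[N in N' *m (N *m _)](trmxCK) -trmxC_mul -/N' -trmxC_mul NN'N.
  have sq : (N - N') *m (N - N') = - (N *m N' + N' *m N).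
    by rewrite mulmxBl !mulmxBr N2 N'2 sub0r subr0 opprD.
  have N'form : N'^T *m O = - (O *m N').
    have tr1 : ((v^T) ^t*)^T = v ^t* by apply/matrixP=> i j; rewrite !mxE.
    have tr2 : (v ^t*)^T = (v^T) ^t* by apply/matrixP=> i j; rewrite !mxE.
    have e1 : O *m N' = (v^T) ^t* *m v ^t*.
      by rewrite /N' trvC mulmxN !mulmxA OO !mulNmx mul1mx opprK.
    have e2 : N'^T = (v^T) ^t* *m v ^t* *m O.
      by rewrite /N' trvC linearN /= !trmx_mul tr1 tr2 OT !mulmxN opprK mulmxA.
    by rewrite e1 e2 -mulmxA OO mulmxN mulmx1.
  apply: comX_deriv.
  - by rewrite linearB map_mxB /= -/N' trmxCK opprB.
  - rewrite sq mulNmx mulmxDl !mulmxBr NN'N N'NN' -(mulmxA N) N'2 mulmx0 subr0.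
    by rewrite -(mulmxA N' N N) N2 mulmx0 sub0r.
  - by rewrite linearB mulmxBl /= trv_form N'form mulmxBr opprB opprK addrC.
have i1 : 'i * ('i : C)^*%R = 1 by rewrite conjCi mulrN -expr2 sqrCi opprK.
(* [trv] is quadratic, so a square root of ['i] on [u] puts the factor ['i] on [trv u]. *)
pose z : C := sqrtC 'i.
have zz : z * z^*%R = 1.
  rewrite -normCK; have : `|z| ^+ 2 = 1 by rewrite -normrX sqrtCK normCi.
  by move=> ->.
have := skew _ u1; have : (z *: u) ^t* *m (z *: u) = 1%:M.
  by rewrite trmxC_scale -scalemxAl -scalemxAr scalerA u1 mulrC zz scale1r.
move/skew; rewrite trvZ sqrtCK trmxC_scale conjCi => c1 c2.
have -> : trv u = 2%:R^-1 *: ((trv u - (trv u) ^t*)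
    + - 'i *: ('i *: trv u - - 'i *: (trv u) ^t*)).
  have i2 : 'i%R ^+ 2 = -1 :> C by rewrite sqrCi.
  move: (trv u) ((trv u) ^t*) => Y Z; apply/matrixP=> p q; rewrite !mxE.
  by field: i2.
by rewrite deriv_tensZ deriv_tensD deriv_tensZ; apply/comXZ/comXD => //; apply: comXZ.
Qed.

Lemma comX_trv u : comX (deriv_tens (trv u)).
Proof.
have [->|u0] := eqVneq u 0.
  have -> : trv 0 = 0 *: trv 0 by rewrite scale0r /trv !mul0mx.
  rewrite deriv_tensZ; apply: comXZ; rewrite /comX /deriv_tens /trv.
  rewrite !mul0mx tensmx0 tens0mx addr0 mul0mx mulmx0; exact: erefl.
pose t := (u ^t* *m u) 0 0.
have t0 : 0 < t.
  rewrite /t mxE lt_neqAle; apply/andP; split; last first.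
    by apply: sumr_ge0 => i _; rewrite !mxE mulrC mul_conjC_ge0.
  apply: contraNneq u0 => /esym/eqP; rewrite psumr_eq0; last first.
    by move=> i _; rewrite !mxE mulrC mul_conjC_ge0.
  move=> /allP u0; apply/eqP/matrixP=> i j; rewrite (ord1 j) [RHS]mxE.
  have /= := u0 i (mem_index_enum _); rewrite !mxE mulrC mul_conjC_eq0.
  by move/eqP.
have -> : u = sqrtC t *: ((sqrtC t)^-1 *: u).
  by rewrite scalerA mulfV ?scale1r // sqrtC_eq0 gt_eqF.
rewrite trvZ deriv_tensZ; apply/comXZ/comX_trv_unit.
rewrite trmxC_scale -scalemxAl -scalemxAr scalerA [u ^t* *m u]mx11_scalar -/t.
rewrite geC0_conj ?invr_ge0 ?sqrtC_ge0 ?(ltW t0) // -invfM -expr2 sqrtCK.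
by rewrite scale_scalar_mx mulVf ?gt_eqF.
Qed.

(** Polarization of [trv] at two basis vectors. *)
Definition trv2 m l : 'M[C]_d :=
  (delta_mx m 0 *m (delta_mx l 0 : 'cV_d)^T + delta_mx l 0 *m (delta_mx m 0 : 'cV_d)^T) *m O.

Lemma trv2E m l p q : trv2 m l p q = (p == m)%:R * O l q + (p == l)%:R * O m q.
Proof.
have E i j : (delta_mx i j *m O) p q = (p == i)%:R * O j q.
  rewrite mxE (bigD1 j) //= big1 => [|r rj]; first by rewrite mxE eqxx andbT addr0.
  by rewrite mxE (negPf rj) andbF mul0r.
by rewrite /trv2 mulmxDl !trmx_delta !mul_delta_mx mxE !E.
Qed.

Lemma trv2_trv m l :
  trv2 m l = trv (delta_mx m 0 + delta_mx l 0) - trv (delta_mx m 0) - trv (delta_mx l 0).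
Proof.
rewrite /trv2 /trv -!mulmxBl; congr (_ *m _); rewrite linearD /= !mulmxDl !mulmxDr.
move: (_ *m _) (_ *m _) (_ *m _) (_ *m _) => Y1 Y2 Y3 Y4.
by apply/matrixP=> p q; rewrite !mxE; ring.
Qed.

Lemma comX_trv2 m l : comX (deriv_tens (trv2 m l)).
Proof.
rewrite trv2_trv -[- trv (delta_mx m 0)]scaleN1r -[- trv (delta_mx l 0)]scaleN1r.
by rewrite !deriv_tensD !deriv_tensZ; do 2?apply: comXD; try apply: comXZ; apply: comX_trv.
Qed.

Lemma trv2_form m l : O *m trv2 m l = - ((trv2 m l)^T *m O).
Proof.
by rewrite trv2_trv !linearB /= !mulmxBl !trv_form !opprD !opprK.
Qed.

Definition lowered : 'M[C]_(d * d) := (O *t O) *m X.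

(** [trv2 m l] is skew for [O], so moving its derivation across [O *t O] transposes it with a sign;
    commutation with [X] becomes invariance of a covariant tensor. *)
Lemma lowered_deriv m l :
  lowered *m deriv_tens (trv2 m l) + (deriv_tens (trv2 m l))^T *m lowered = 0.
Proof.
rewrite /lowered -mulmxA -(comX_trv2 m l) !mulmxA -mulmxDl.
set M := trv2 m l; suff -> : O *t O *m deriv_tens M = - ((deriv_tens M)^T *m (O *t O)).
  by rewrite addNr mul0mx.
have M1 : M^T *m O = - (O *m M) by rewrite trv2_form opprK.
rewrite /deriv_tens [in RHS]linearD /= !trmx_tens !trmx1 mulmxDl mulmxDr !tensmx_mul.
rewrite !mulmx1 !mul1mx M1 -!scaleN1r tensZl tensZr -scalerDr scalerA mulrNN mulr1.
by rewrite scale1r.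
Qed.

Lemma mul_tens1 (Y : 'M[C]_(d * d)) A p c e :
  (Y *m (A *t 1%:M)) p (mxtens_index (c, e))
  = \sum_q Y p (mxtens_index (q, e)) * A q c.
Proof.
rewrite mxE sum_tens; apply: eq_bigr => i _; rewrite (bigD1 e) //= big1 => [|j je].
  by rewrite tensmxE mxE eqxx mulr1 addr0.
by rewrite tensmxE mxE (negPf je) !mulr0.
Qed.

Lemma mul_1tens (Y : 'M[C]_(d * d)) A p c e :
  (Y *m (1%:M *t A)) p (mxtens_index (c, e))
  = \sum_q Y p (mxtens_index (c, q)) * A q e.
Proof.
rewrite mxE sum_tens exchange_big /=; apply: eq_bigr => i _.
rewrite (bigD1 c) //= big1 => [|j jc].
  by rewrite tensmxE mxE eqxx mul1r addr0.
by rewrite tensmxE mxE (negPf jc) mul0r mulr0.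
Qed.

Lemma sum_trv2 (f : 'I_d -> C) m l c :
  \sum_q f q * trv2 m l q c = f m * O l c + f l * O m c.
Proof.
under eq_bigr do rewrite trv2E mulrDr.
rewrite big_split /= -[f m * _](contract_delta (fun q => f q * O l c)).
rewrite -[f l * _](contract_delta (fun q => f q * O m c)).
by congr (_ + _); apply: eq_bigr => q _; rewrite mulrCA.
Qed.

Lemma lowered_invariant :
  invariant4 O (fun a b c e => lowered (mxtens_index (a, b)) (mxtens_index (c, e))).
Proof.
move=> m l a b c e.
have := congr1 (fun M : 'M_(d * d) => M (mxtens_index (a, b)) (mxtens_index (c, e)))
  (lowered_deriv m l).
(* Transposing the second term lets the formulas for right multiplication serve both pairs of
   slots. *)
rewrite -[_^T *m _]trmxK trmx_mul trmxK /deriv_tens !mulmxDr.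
have E (U V W Z : 'M[C]_(d * d)) p q : (U + V + (W + Z)^T) p q = U p q + V p q + W q p + Z q p.
  by rewrite !mxE addrA.
rewrite E !mul_tens1 !mul_1tens !sum_trv2 [RHS]mxE => <-; rewrite ![_^T _ _]mxE.
ring.
Qed.

Lemma commutant_forms : (2 < d)%N -> exists al be ga, forall a b c e,
  lowered (mxtens_index (a, b)) (mxtens_index (c, e))
    = al * (O a c * O b e) + be * (O a e * O b c) + ga * (O a b * O c e).
Proof.
move=> d2; apply: (invariant4_forms _ _ d2 lowered_invariant) => i j.
  by have := congr1 (fun M : 'M_d => M i j) OT; rewrite !mxE.
have := congr1 (fun M : 'M_d => M i j) OO; rewrite !mxE => OOij.
rewrite -[RHS]opprK -OOij -sumrN; apply: eq_bigr => m _.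
have := congr1 (fun M : 'M_d => M j m) OT; rewrite !mxE => ->.
by rewrite mulrN opprK.
Qed.

End Commutant.
(** * Schmidt numbers in the family *)

Section Family.
Variables (R : realType) (d : nat).
Hypothesis d_even : ~~ odd d.
Local Notation C := (R[i]).
Local Notation O := (Omega R d).
Implicit Types (M N : 'M[C]_d) (X Y : 'M[C]_(d * d)).

(** Coefficient matrices get multiplied by the transpose of [Omega], which cannot raise the rank,
    and unitarity preserves norms. *)
Lemma decomposable_twist k X : schmidt_decomposable k X -> schmidt_decomposable k (twist X).
Proof.
move=> [n [p [xi [p0 p1 xi1 xik ->]]]].
exists n, p, (fun l => IOmega R d *m xi l); split=> // [l|l|].
- rewrite trmxC_mul mulmxA -[_ *m IOmega R d]mulmxA (mulmx1C (IOmega_unitary R d_even)).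
  by rewrite mulmx1 xi1.
- rewrite /schmidt_rank -/(unvc _) -(unvcK (xi l)) tens_vc vcK mul1mx.
  exact: leq_trans (mxrankM_maxl _ _) (xik l).
- rewrite /twist mulmx_sumr mulmx_suml; apply: eq_bigr => l _.
  by rewrite -scalemxAr -scalemxAl trmxC_mul !mulmxA.
Qed.

Lemma SN_twist X : quantum_state X -> SN (twist X) = SN X.
Proof.
move=> qX; have qcX : quantum_state (twist X) by apply/quantum_state_twist.
have SNX k : (SN (twist X) <= k)%N <-> (SN X <= k)%N.
  rewrite !SN_leP //; split=> [/decomposable_twist|/decomposable_twist //].
  by rewrite twist_twist.
by apply/eqP; rewrite eqn_leq (SNX _).2 // (SNX _).1.
Qed.

Lemma omega_dyad : omega R d *m (omega R d) ^t* = d%:R^-1 *: dyad 1%:M 1%:M.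
Proof.
have -> : omega R d = (sqrtC d%:R)^-1 *: vc 1%:M.
  rewrite /omega mx1_sum_delta vc_sum; congr (_ *: _).
  by apply: eq_bigr => i _; rewrite ket_vc.
rewrite trmxC_scale -scalemxAl -scalemxAr scalerA -/(dyad _ _); congr (_ *: _).
by rewrite geC0_conj ?invr_ge0 ?sqrtC_ge0 ?ler0n // -invfM -expr2 sqrtCK.
Qed.

(** Symmetric in [a] and [b], as [rho_swap] requires. *)
Definition mixed_coef (a b : R) : C := ((1 - a - b) / d%:R ^+ 2)%:C.

Lemma realc_div (a : R) : (a / d%:R)%:C = a%:C * d%:R^-1 :> C.
Proof. by rewrite rmorphM fmorphV rmorph_nat. Qed.

(** The twist turns [dyad O O] into [dyad 1 1], which is [d] times the projector on [omega]: hence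
    [a] goes with [dyad O O] and [b] with the flip. *)
Lemma rho_twist (a b : R) :
  rho d a b = twist (spmx d (mixed_coef a b) (b / d%:R)%:C (a / d%:R)%:C).
Proof.
have -> : rho d a b = mixed_coef a b *: 1%:M + a%:C *: (omega R d *m (omega R d) ^t* )
    + (b / d%:R)%:C *: twist (Flip R d) by [].
have -> : a%:C *: (omega R d *m (omega R d) ^t* ) = (a / d%:R)%:C *: dyad 1%:M 1%:M.
  by rewrite omega_dyad scalerA realc_div.
rewrite /spmx !twistD !twistZ (twist1 R d_even) twist_dyad (OmegaV R d_even).
exact: addrAC.
Qed.

Lemma ptrans_rho (a b : R) :
  ptrans (rho d a b) = spmx d (mixed_coef a b) (a / d%:R)%:C (b / d%:R)%:C.
Proof. by rewrite rho_twist -(ptrans_spmx d_even) ptransK. Qed.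

Lemma rho_swap (a b : R) : rho d b a = twist (ptrans (rho d a b)).
Proof. by rewrite ptrans_rho rho_twist /mixed_coef addrAC. Qed.

(** The defining relation gives [S] the left inverse [- (O *m S^T *m O)], which is then also a right
    inverse. *)
Lemma Sp_preserves (S : 'M[C]_d) : Sp S -> S *m O *m S^T = O.
Proof.
move=> [_ SO].
have inv1 : (- (O *m S^T *m O)) *m S = 1%:M.
  by rewrite mulNmx -!mulmxA (mulmxA S^T) SO (Omega_sqr R d_even) opprK.
have := mulmx1C inv1; rewrite mulmxN !mulmxA => inv2.
have := congr1 (fun A => A *m O) inv2.
by rewrite /= mulNmx -(mulmxA _ O O) (Omega_sqr R d_even) mulmxN mulmx1 opprK mul1mx.
Qed.

Lemma Sp_tens_unitary (S : 'M[C]_d) : Sp S ->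
  (S *t S) *m (S *t S) ^t* = 1%:M.
Proof.
move=> [/unitarymxP SS _]; apply: vc_eqP => M.
rewrite trmxC_tens -mulmxA !tens_vc !mulmxA SS !mul1mx -mulmxA -trmx_mul SS.
by rewrite trmx1 mulmx1.
Qed.

Lemma SS_invariant_spmx (al be ga : C) : SS_invariant (spmx d al be ga).
Proof.
move=> S SpS; have U := Sp_tens_unitary SpS.
have FS : (S *t S) *m Flip R d = Flip R d *m (S *t S).
  by apply: vc_eqP => M; rewrite -!mulmxA Flip_vc !tens_vc Flip_vc !trmx_mul trmxK mulmxA.
rewrite /spmx !mulmxDr !mulmxDl -!scalemxAr -!scalemxAl mulmx1 U FS -mulmxA U mulmx1.
by rewrite tens_dyad Sp_preserves.
Qed.

Lemma tens_Omega_spmx al be ga a b c e :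
  ((O *t O) *m spmx d al be ga) (mxtens_index (a, b)) (mxtens_index (c, e))
  = al * (O a c * O b e) + be * (O a e * O b c) + ga * (O a b * O c e).
Proof.
have E (x y z : C) (U V W : 'M[C]_(d * d)) p q :
    (x *: U + y *: V + z *: W) p q = x * U p q + y * V p q + z * W p q.
  by rewrite !mxE.
rewrite /spmx !mulmxDr -!scalemxAr E mulmx1 tensmxE; congr (_ + _ * _ + _ * _).
- rewrite mxE sum_tens -(contract_delta (fun i => O a i * O b c) e).
  apply: eq_bigr => i _; rewrite -(contract_delta (fun j => O a i * O b j) c) mulr_sumr.
  by apply: eq_bigr => j _; rewrite tensmxE Flip_entry; ring.
- rewrite /dyad mulmxA tens_vc -mulmxA (OmegaV R d_even) mulmx1 -/(dyad _ _) dyadE.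
  by rewrite Omega_conj.
Qed.

(** [O *t O] is its own inverse, so [X] is recovered from its lowered tensor; [tens_Omega_spmx]
    matches the three forms with the family. *)
Lemma SS_invariant_form X : (2 < d)%N -> SS_invariant X ->
  exists al be ga, X = spmx d al be ga.
Proof.
move=> d2 invX; have comm S : S \is unitarymx -> S^T *m O *m S = O ->
    (S *t S) *m X = X *m (S *t S).
  move=> US SO; have SpS : Sp S by [].
  by rewrite -{2}(invX S SpS) -[RHS]mulmxA (mulmx1C (Sp_tens_unitary SpS)) mulmx1.
have [al [be [ga XE]]] := commutant_forms (Omega_tr R d) (Omega_sqr R d_even)
  (Omega_trC R d) comm d2.
exists al, be, ga; have OO1 : (O *t O) *m (O *t O) = 1%:M.
  apply: vc_eqP => M; rewrite -mulmxA !tens_vc mul1mx !mulmxA (Omega_sqr R d_even) -mulmxA.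
  by rewrite -trmx_mul (Omega_sqr R d_even) linearN /= trmx1 mulmxN mulNmx mulmx1 mul1mx opprK.
rewrite -[LHS]mul1mx -[RHS]mul1mx -OO1 -!mulmxA; congr (_ *m _).
by apply: tens_eqP => a b c e; rewrite tens_Omega_spmx -XE.
Qed.

(* The range of [1 + F + dyad O O] consists of the vectors whose alternating part is
   a multiple of the nondegenerate form [O]. *)
Lemma decomposable_rank k (t : C) : (0 < d)%N -> t != 0 ->
  schmidt_decomposable k (spmx d t t t) -> (d./2 <= k)%N.
Proof.
move=> d0 t0 [m [p [xi [p0 _ _ xik XE]]]]; rewrite leqNgt; apply/negP => kd.
have dn0 : d%:R != 0 :> C by rewrite pnatr_eq0 -lt0n.
pose f M : C := \sum_i \sum_j O i j * M i j.
have fD M N : f (M + N) = f M + f N.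
  rewrite /f -big_split; apply: eq_bigr => i _; rewrite -big_split.
  by apply: eq_bigr => j _; rewrite [(M + N) i j]mxE mulrDr.
have fZ c M : f (c *: M) = c * f M.
  rewrite /f mulr_sumr; apply: eq_bigr => i _; rewrite mulr_sumr.
  by apply: eq_bigr => j _; rewrite [(c *: M) i j]mxE mulrCA.
have fT M : f M^T = - f M.
  rewrite /f exchange_big -sumrN; apply: eq_bigr => i _; rewrite -sumrN.
  by apply: eq_bigr => j _; rewrite Omega_anti [M^T _ _]mxE mulNr.
have fO : f O = d%:R by apply: Omega_norm.
(* [Z] sends [M] to [M - M^T] minus its component along [O], so it annihilates the range of the
   given operator. *)
pose Z : 'M[C]_(d * d) := spmx d 1 (- 1) (- (2%:R / d%:R)).
have ZX : Z *m spmx d t t t = 0.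
  apply: vc_eqP => M; rewrite mul0mx -mulmxA !spmx_vc -/(f _) -/(f _) !fD !fZ fO fT.
  have lin (M' W : 'M[C]_d) (s : C) : 1 *: (t *: M + t *: M' + (t * s) *: W)
      + (- 1) *: (t *: M' + t *: M + (t * s) *: - W)
      + (- (2%:R / d%:R) * (t * s + t * - s + t * s * d%:R)) *: W = 0.
    by apply/matrixP=> i j; rewrite !mxE; field.
  have -> : (t *: M + t *: M^T + (t * f M) *: O)^T
      = t *: M^T + t *: M + (t * f M) *: - O.
    by rewrite !linearD !linearZ /= trmxK Omega_tr.
  rewrite lin.
  by rewrite -(scale0r (0 : 'M_d)) vcZ scale0r.
(* Conjugating the decomposition by [Z] gives a sum of dyads with nonnegative weights and total
   trace zero, so each term vanishes. *)
have Zxi l : p l != 0 -> Z *m xi l = 0.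
  move=> pl0; apply/eqP; rewrite -[_ *m xi l]unvcK; set N := unvc _.
  have [->|N0] := eqVneq N 0; first by rewrite -(scale0r (0 : 'M_d)) vcZ scale0r.
  have : \tr (Z *m spmx d t t t *m Z ^t*) = 0 by rewrite ZX mul0mx linear0.
  have -> : Z *m spmx d t t t *m Z ^t*
      = \sum_i (p i)%:C *: dyad (unvc (Z *m xi i)) (unvc (Z *m xi i)).
    rewrite XE mulmx_sumr mulmx_suml; apply: eq_bigr => i _.
    by rewrite -scalemxAr -scalemxAl /dyad unvcK trmxC_mul !mulmxA.
  rewrite linear_sum /= => /eqP.
  have tr_ge0 M : 0 <= \tr (dyad M M).
    have [->|/tr_dyad_gt0/ltW //] := eqVneq M 0.
    by rewrite -(scale0r (0 : 'M_d)) dyadZ mul0r scale0r linear0.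
  rewrite psumr_eq0 => [/allP/(_ l (mem_index_enum _))/=|i _]; last first.
    by rewrite linearZ /= mulr_ge0 // ler0c.
  by rewrite linearZ /= mulf_eq0 (gt_eqF (tr_dyad_gt0 N0)) orbF fmorph_eq0 (negPf pl0).
have alt_xi l : p l != 0 -> f (unvc (xi l)) = 0.
  move=> /Zxi; rewrite -{1}(unvcK (xi l)) spmx_vc -/(f _); set M := unvc (xi l).
  move=> /(congr1 (@unvc _ _)); rewrite vcK => ZM.
  have altM : M - M^T = (2%:R / d%:R * f M) *: O.
    have {}ZM : 1 *: M + -1 *: M^T + (- (2%:R / d%:R) * f M) *: O = 0.
      by rewrite ZM; apply/matrixP=> i j; rewrite !mxE.
    by apply/eqP; rewrite -subr_eq0 -ZM scale1r scaleN1r mulNr scaleNr.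
  (* Otherwise [M - M^T] would be a nonzero multiple of [O], of rank [d], although its rank is at
     most [2 k < d]. *)
  apply/eqP; apply/negPn/negP => fM0.
  have c0 : 2%:R / d%:R * f M != 0.
    apply: mulf_neq0 fM0; apply: mulf_neq0; last by rewrite invr_eq0.
    by rewrite pnatr_eq0.
  have rO : \rank O = d.
    by apply: mxrank_unit; case: (mulmx1_unit (OmegaV R d_even)).
  have : (\rank (M - M^T)%R <= k + k)%N.
    apply: leq_trans (mxrank_add _ _) _; rewrite mxrank_opp mxrank_tr.
    by apply: leq_add; apply: xik.
  rewrite altM (eqmx_scale _ c0) rO addnn -(even_halfK d_even) leq_double.
  by rewrite leqNgt kd.
(* All contributing vectors are now orthogonal to [O], yet [vc O] is an eigenvector of the operator
   with eigenvalue [t * d]. *)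
have : dyad O O *m spmx d t t t = 0.
  rewrite XE mulmx_sumr big1 // => l _; rewrite -scalemxAr mulmxA.
  have [->|/alt_xi fM] := eqVneq (p l) 0; first by rewrite scale0r.
  rewrite -{1}(unvcK (xi l)) dyad_vc; set s := \sum_i _.
  have -> : s = f (unvc (xi l)).
    by do 2 apply: eq_bigr => ? _; rewrite Omega_conj.
  by rewrite fM scale0r mul0mx scaler0.
move/(congr1 (fun A => A *m vc O)); rewrite /= mul0mx -mulmxA spmx_vc -/(f _) fO.
rewrite Omega_tr -/(f _) dyad_vc.
have -> : \sum_i \sum_j (O i j)^*%R * (t *: O + t *: - O + (t * d%:R) *: O) i j
    = f (t *: O + t *: - O + (t * d%:R) *: O).
  by do 2 apply: eq_bigr => ? _; rewrite Omega_conj.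
rewrite scalerN subrr add0r fZ fO => /(congr1 (@unvc _ _)).
rewrite -vcZ vcK => /(congr1 f); rewrite fZ fO.
have -> : unvc (0 : 'cV[C]_(d * d)) = 0 *: O.
  by rewrite scale0r; apply/matrixP=> i j; rewrite !mxE.
rewrite fZ mul0r => /eqP.
by rewrite !mulf_eq0 (negPf t0) (negPf dn0).
Qed.

End Family.

(** * The symplectic form as a sum of pair vectors *)

Section EvenDimension.
Variables (R : realType) (n : nat).
Local Notation C := (R[i]).

Lemma Omega_pairu : Omega R (n + n) = omegau C n.
Proof.
rewrite [LHS]matrix_sum_delta Omega_block big_split_ord /=.
under eq_bigr => i _.
  rewrite big_split_ord /= big1 => [|j _]; last by rewrite block_mxEul mxE scale0r.
  rewrite add0r (bigD1 i) //= big1 => [|j ji]; last first.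
    by rewrite block_mxEur mxE eq_sym (negPf ji) scale0r.
  rewrite block_mxEur mxE eqxx scale1r addr0; over.
under [X in _ + X]eq_bigr => i _.
  rewrite big_split_ord /= [X in _ + X]big1 => [|j _]; last by rewrite block_mxEdr mxE scale0r.
  rewrite addr0 (bigD1 i) //= big1 => [|j ji]; last first.
    by rewrite block_mxEdl !mxE eq_sym (negPf ji) oppr0 scale0r.
  rewrite block_mxEdl !mxE eqxx scaleN1r addr0; over.
by rewrite -big_split.
Qed.

End EvenDimension.

(** * PPT members of the family and the final theorem *)

Section PPT.
Variables (R : realType) (d : nat).
Hypotheses (d_even : ~~ odd d) (d4 : (4 <= d)%N).
Local Notation C := (R[i]).

Lemma sncone_constraints (al be ga : C) :
  0 <= al - be -> 0 <= al - be + ga * d%:R ->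
  0 <= al - ga -> 0 <= al - ga + be * d%:R -> sncone d./2 (spmx d al be ga).
Proof.
have [n dE] : exists n, d = (n + n)%N by exists d./2; rewrite addnn even_halfK.
subst d; rewrite addnn doubleK -addnn => h1 h2 h3 h4.
rewrite /spmx FlipE Omega_pairu; apply: sncone_spmx h1 h2 h3 h4.
by lia.
Qed.

(** [psd_spmx] for the operator and for its untwisted partial transpose yields the four
    inequalities. *)
Lemma sncone_PPT (al be ga : C) :
  psd (spmx d al be ga) -> psd (ptrans (spmx d al be ga)) ->
  sncone d./2 (spmx d al be ga).
Proof.
rewrite (ptrans_spmx d_even) (psd_twist d_even) => pX pX'.
have [h1 h2] := psd_spmx d_even d4 pX; have [h3 h4] := psd_spmx d_even d4 pX'.
exact: sncone_constraints.
Qed.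

End PPT.

Theorem theorem4p4 (R : realType) (d : nat) (hd4 : (4 <= d)%N)
    (hdeven : ~~ odd d) :
  (forall a b : R, state_region R d (b, a) ->
     [/\ ptrans (rho d a b) =
           ((1 - a - b) / d%:R ^+ 2)%:C *: 1%:M
           + (a / d%:R)%:C *: Flip R d
           + b%:C *: (IOmega R d *m (omega R d *m (omega R d) ^t* )
                        *m (IOmega R d) ^t* ),
         quantum_state (ptrans (rho d a b)),
         SS_invariant (ptrans (rho d a b))
       & SN (ptrans (rho d a b)) = SN (rho d b a)]
     /\ [/\ PPT_state (ptrans (rho d a b)) <-> PPT_region R d (b, a),
            PPT_region R d (b, a) <-> PPT_region R d (a, b)
          & forall k : nat,
              (SN (ptrans (rho d a b)) <= k)%N <-> SN_region R d k (b, a)])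
  /\ (exists X : 'M[R[i]]_(d * d),
        [/\ SS_invariant X, PPT_state X & SN X = d./2])
  /\ (forall X : 'M[R[i]]_(d * d),
        SS_invariant X -> PPT_state X -> (SN X <= d./2)%N).
Proof.
have d0 : (0 < d)%N by apply: leq_trans hd4.
split; last split.
- move=> a b; rewrite /state_region /PPT_region /SN_region /= => qs_ba.
  have qs_G : quantum_state (ptrans (rho d a b)).
    apply: (proj1 (quantum_state_twist hdeven (ptrans (rho d a b)))).
    by rewrite -(rho_swap hdeven a b).
  have SN_G : SN (ptrans (rho d a b)) = SN (rho d b a).
    by rewrite (rho_swap hdeven a b) (SN_twist hdeven qs_G).
  (* This is [rho_swap] with the parameters exchanged; it makes the PPT condition symmetric in [a]
     and [b]. *)
  have psd_ba : psd (ptrans (rho d b a)) <-> psd (rho d a b).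
    rewrite [X in psd X <-> _](_ : _ = twist (rho d a b)); first exact: psd_twist.
    by rewrite (rho_swap hdeven b a) (twist_twist hdeven).
  (* The trace sees the last two coefficients of [spmx] only through their sum. *)
  have tr_ab : \tr (rho d a b) = 1.
    transitivity (\tr (ptrans (rho d a b))); last by have [] := qs_G.
    rewrite (ptrans_rho hdeven a b) (rho_twist hdeven a b) (tr_twist hdeven).
    by rewrite !(tr_spmx hdeven) [X in _ + X * _]addrC.
  split; split.
  + rewrite (ptrans_rho hdeven) /spmx -/(twist _) omega_dyad twistZ twist_dyad mul1mx Omega_tr.
    by rewrite dyadNl dyadNr opprK scalerA -(realc_div d b).
  + exact: qs_G.
  + by rewrite (ptrans_rho hdeven); apply: SS_invariant_spmx.
  + exact: SN_G.
  + rewrite /PPT_state ptransK psd_ba; split=> [[_ h]|[_ h]].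
      exact: (conj qs_ba h).
    exact: (conj qs_G h).
  + rewrite /PPT_state psd_ba; split=> [[_ h]|[h _]].
      exact: (conj (conj h tr_ab) (proj1 qs_G)).
    exact: (conj qs_ba (proj1 h)).
  + by move=> k; rewrite SN_G; split=> [|[]].
- have d_pos : 0 < d%:R :> R[i] by rewrite ltr0n.
  (* Normalizes the ray [I + F + P'], whose partial transpose is its own twist because its last two
     coefficients agree. *)
  pose t : R[i] := (d%:R ^+ 2 + (1 + 1) * d%:R)^-1.
  have t_pos : 0 < t by rewrite invr_gt0 addr_gt0 ?mulr_gt0 ?exprn_gt0 ?addr_gt0 ?ltr01.
  have trX : \tr (spmx d t t t) = 1.
    rewrite (tr_spmx hdeven) -[t in X in _ + X](mulr1 t) -mulrDr -mulrA -mulrDr.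
    by rewrite mulVf // -invr_eq0 gt_eqF.
  have coneX : sncone d./2 (spmx d t t t).
    have [h1 h2] : 0 <= t - t /\ 0 <= t - t + t * d%:R.
      by rewrite subrr add0r; split; [exact: lexx|apply: mulr_ge0; apply: ltW].
    exact: sncone_constraints.
  have psdX := sncone_psd coneX.
  have qsX : quantum_state (spmx d t t t) by split.
  exists (spmx d t t t); split.
  + exact: SS_invariant_spmx.
  + split; first exact: qsX.
    by rewrite (ptrans_spmx hdeven); apply: (proj2 (psd_twist hdeven _) psdX).
  + apply/eqP; rewrite eqn_leq; apply/andP; split.
      by apply/(SN_leP _ qsX); apply: sncone_decomposable.
    apply: (decomposable_rank hdeven d0 (lt0r_neq0 t_pos)).
    exact/(SN_leP _ qsX).
(* Invariance puts [X] in the family, where the PPT condition places it in the cone of rank bound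
   [d./2]. *)
- move=> X invX [qsX psdX']; apply/(SN_leP _ qsX).
  have [al [be [ga XE]]] := SS_invariant_form hdeven (leq_trans (isT : 2 < 4)%N hd4) invX.
  apply: sncone_decomposable; last by case: qsX.
  have psdX := proj1 qsX; rewrite XE in psdX psdX' *.
  exact: (sncone_PPT hdeven hd4 psdX psdX').
Qed.
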